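(* If $1<q<p<2$, then $\Gamma_{\rm i}(L_{p,q})\neq\Gamma_{\rm iid}(L_{p,q})$.
   Context: For measurable $x$ on $[0,1]$ (Lebesgue measure $m$), $x^*(t)=\inf\{s\ge0:m(|x|>s)\le t\}$. For $1\le q\le p<\infty$, $1<p$, $L_{p,q}$ is the Lorentz space of measurable functions on $[0,1]$ with finite norm $\|x\|_{p,q}=\frac qp\left(\int_0^1\left(x^*(t)t^{1/p}\right)^q\frac{dt}{t}\right)^{1/q}$. For a Banach function space $E$ on $[0,1]$ and $s\ge1$, a bounded sequence $\{x_n\}\subset E$ is an $s$-BS-sequence if for every subsequence $\{y_k\}\subset\{x_n\}$ one has $\sup_{j\in\mathbb N}j^{-1/s}\|\sum_{k=1}^jy_k\|_E<\infty$. $\Gamma_{\rm i}(E)$ (respectively $\Gamma_{\rm iid}(E)$) is the set of all $s\ge1$ such that every weakly null sequence in $E$ of independent random variables (respectively, of independent identically distributed random variables) contains a subsequence which is an $s$-BS-sequence. *)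

(* Defs.v *)
From HB Require Import structures.
From mathcomp Require Import all_boot all_order all_algebra.
From mathcomp Require Import all_classical all_reals all_analysis.
Import Order.TTheory GRing.Theory Num.Theory.
Import numFieldNormedType.Exports.

Set Implicit Arguments.
Unset Strict Implicit.
Unset Printing Implicit Defensive.

Local Open Scope classical_set_scope.
Local Open Scope ring_scope.
Local Open Scope ereal_scope.

(* Functions on [0,1] are represented by functions [R -> R], whose values
   outside [0,1] are ignored: measurability is required on [0,1] only, and every
   measure or integral below only sees [0,1]. *)

Definition leb01 (R : realType) : set R -> \bar R :=
  mrestr lebesgue_measure (measurable_itv `[0%R, 1%R]).

(* Extended-real valued: x^*(0) = +oo when x is essentially unbounded. *)
Definition rearrangement (R : realType) (x : R -> R) (t : R) : \bar R :=
  ereal_inf [set s%:E | s in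
    [set s : R | (0 <= s)%R /\ leb01 [set u | (s < `|x u|)%R] <= t%:E]].

Definition lorentz_norm (R : realType) (p q : R) (x : R -> R) : \bar R :=
  (q / p)%:E *
  (\int[lebesgue_measure]_(t in `]0%R, 1%R[)
     ((rearrangement x t * (t `^ p^-1)%:E) `^ q * t^-1%:E)) `^ q^-1.

(* A function space E on [0,1] is given by its norm [N], with value +oo outside
   E. Elements are functions rather than classes modulo a.e. equality; [N] then
   being a seminorm on E, bounded functionals on E and on the quotient agree. *)
Definition fspace (R : realType) (N : (R -> R) -> \bar R) : set (R -> R) :=
  [set x | measurable_fun (`[0%R, 1%R] : set R) x /\ N x < +oo].

(* Bounded linear functionals on E; their values outside E are irrelevant. *)
Definition fdual (R : realType) (N : (R -> R) -> \bar R) :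
    set ((R -> R) -> R) :=
  [set phi |
    (forall (a : R) (x y : R -> R), fspace N x -> fspace N y ->
       phi (fun t => a * x t + y t)%R = (a * phi x + phi y)%R) /\
    (exists C : R, forall x, fspace N x -> `|phi x|%:E <= C%:E * N x)].

Definition weakly_null (R : realType) (N : (R -> R) -> \bar R)
    (x : nat -> R -> R) : Prop :=
  (forall n, fspace N (x n)) /\
  (forall phi, fdual N phi -> phi (x n) @[n --> \oo] --> (0%R : R)).

Definition independent (R : realType) (x : nat -> R -> R) : Prop :=
  forall (I : seq nat) (B : nat -> set R), uniq I ->
    (forall i, measurable (B i)) ->
    leb01 (\bigcap_(i in [set` I]) (x i @^-1` B i)) =
    \prod_(i <- I) leb01 (x i @^-1` B i).

Definition identically_distributed (R : realType) (x : nat -> R -> R) : Prop :=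
  forall (m n : nat) (B : set R), measurable B ->
    leb01 (x m @^-1` B) = leb01 (x n @^-1` B).

Definition BS_sequence (R : realType) (N : (R -> R) -> \bar R) (s : R)
    (x : nat -> R -> R) : Prop :=
  [/\ forall n, fspace N (x n),
      ereal_sup [set N (x n) | n in [set: nat]] < +oo &
      forall k : nat -> nat, increasing_seq k ->
        ereal_sup [set (j%:R `^ (- s^-1))%:E *
                       N (fun t => \sum_(i < j) x (k i) t)%R
                  | j in [set j : nat | (0 < j)%N]] < +oo].

Definition has_BS_subsequence (R : realType) (N : (R -> R) -> \bar R) (s : R)
    (x : nat -> R -> R) : Prop :=
  exists2 k : nat -> nat, increasing_seq k & BS_sequence N s (x \o k).

Definition Gamma_i (R : realType) (N : (R -> R) -> \bar R) : set R :=
  [set s | (1 <= s)%R /\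
    forall x : nat -> R -> R,
      weakly_null N x -> independent x -> has_BS_subsequence N s x].

Definition Gamma_iid (R : realType) (N : (R -> R) -> \bar R) : set R :=
  [set s | (1 <= s)%R /\
    forall x : nat -> R -> R,
      weakly_null N x -> independent x -> identically_distributed x ->
      has_BS_subsequence N s x].

(* Main.v *)
Require Import Defs.
From HB Require Import structures.
From mathcomp Require Import all_boot all_order all_algebra.
From mathcomp Require Import all_classical all_reals all_analysis.
From mathcomp Require Import measurable_realfun.
From mathcomp Require Import ring lra zify.
Import Order.TTheory GRing.Theory Num.Theory.
Import numFieldNormedType.Exports.

Set Implicit Arguments.
Unset Strict Implicit.
Unset Printing Implicit Defensive.

Local Open Scope classical_set_scope.
Local Open Scope ring_scope.

(** The number [p] separates the two sets: it belongs to Gamma_iid, because iid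
sums of length n have norm O(n^(1/p)), and not to Gamma_i, because independent
bumps of rapidly increasing height behave like the unit vectors of l_q.

Put r = q/p < 1. Up to a constant factor, the q-th power of the norm is
I(x) = int_0^1 x*(t)^q t^(r-1) dt ([lorentz_int]). Since d^r and
int_0^d t^(r-1) dt are comparable, bounding x*^q by a combination of indicators
of intervals ]0, d[ amounts to bounding I(x) by the same combination of the
numbers d^r ([lorentz_int_le], [lorentz_int_ge]). With dyadic levels, and for
every M > 0, this bounds I(x) by a constant times
M^q + sum_k (M 2^k)^q m(|x| > M 2^k)^r ([lorentz_int_le_dyadic]), and the sum over
k by a constant times I(x) ([lorentz_int_ge_dyadic]).

Membership in Gamma_iid. The functional x |-> int x is bounded on L_(p,q)
([mean01_fdual]), so a weakly null iid sequence has mean zero. Let S be the sum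
of n of its terms, all distributed as x, and put M = (n A)^(1/p) with
A >= E|x|^p. For a level u >= M, truncation at u and Chebyshev's inequality give
([tail_sum_iid])
  m(|S| > 2u) <= n m(|x| > u) + g(u),  where g(u) = n E[x^2 ; |x| <= u] / u^2.
One has g(M) <= 1 and g(2u) <= g(u)/4 + n m(|x| > u). As y |-> y^r is
subadditive for r <= 1, each of the numbers u^q g(u)^r along u = M 2^k is at
most 2^q 4^(-r) times the preceding one plus a multiple of u^q (n m(|x| > u))^r.
The ratio 2^q 4^(-r) is less than 1 because p < 2, and the sum of the remainders
is O(n^r) because I(x) is finite. Hence I(S) = O(n^r) ([lorentz_int_sum_iid]).
This is real interpolation between the L_1 and L_2 bounds for sums, carried out
by hand.

Failure of Gamma_i. Let x_k = c_k 1_(A_k), where the A_k are independent,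
m(A_k) = c_k^(-p) and c_(k+1) >= 2 c_k. At almost every point the largest
nonzero term of a sum of such bumps controls the sum up to a factor 2, and this
makes I of a sum of n terms at least n/2 ([lorentz_int_bump_ge]), and O(n) for
coefficients in [-1, 1] ([lorentz_int_bump_le]). The upper bound makes the
sequence weakly null: if |phi(x_k)| >= e along a subsequence, a choice of signs
gives n e = O(n^(1/q)), which is absurd for q > 1. By the lower bound every
subsequence has sums of norm at least a multiple of n^(1/q), which is not
O(n^(1/p)). The set A_k consists of the points whose k-th digit is 0 in the
mixed radix expansion with bases 4, 4^2, 4^3, ... *)

(** * Lacunary sums and real powers *)

Lemma lacunary_sum (R : realFieldType) (v : nat -> R) (n : nat) :
  (forall k, 0 <= v k) -> (forall k, 2 * v k <= v k.+1) ->
  \sum_(k < n) v k <= v n.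
Proof.
move=> v0 v2; elim: n => [|n IH]; first by rewrite big_ord0.
by rewrite big_ord_recr/= (le_trans _ (v2 n))// mulr2n mulrDl !mul1r lerD2r.
Qed.

(** The last admissible term dominates the sum of all the earlier ones. *)
Lemma lacunary_sum_max (R : realFieldType) (v : nat -> R) (b : nat -> bool)
    (z : R) (n : nat) :
  (forall k, 0 <= v k) -> (forall k, 2 * v k <= v k.+1) -> 0 <= z ->
  (forall k, (k < n)%N -> b k -> v k <= z) ->
  \sum_(k < n) v k * (b k)%:R <= 2 * z.
Proof.
move=> v0 v2 z0; elim: n => [|n IH] bz; first by rewrite big_ord0 mulr_ge0.
rewrite big_ord_recr/=; have [bn|/negbTE bn] := boolP (b n); last first.
  by rewrite mulr0 addr0 IH// => k kn; apply: bz; rewrite ltnS ltnW.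
have vz : v n <= z by exact: bz.
rewrite mulr1 (le_trans (lerD (y := v n) _ (lexx _)))//; last by lra.
apply: le_trans (lacunary_sum n v0 v2); apply: ler_sum => k _.
by case: (b k); rewrite ?mulr1// mulr0.
Qed.

Lemma lacunary_decr_sum (R : realFieldType) (a : nat -> R) (n : nat) :
  (forall k, 2 * a k.+1 <= a k) -> \sum_(k < n) a k.+1 + a n <= a 0%N.
Proof.
move=> a2; elim: n => [|n IH]; first by rewrite big_ord0 add0r.
by rewrite big_ord_recr/=; have := a2 n; lra.
Qed.

(** Mirror image of [lacunary_sum_max]: here the first admissible term dominates
all the later ones. *)
Lemma lacunary_decr_sum_max (R : realFieldType) (a : nat -> R) (b : nat -> bool)
    (z : R) (n : nat) :
  (forall k, 0 <= a k) -> (forall k, 2 * a k.+1 <= a k) -> 0 <= z ->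
  (forall k, b k -> a k <= z) -> \sum_(k < n) a k * (b k)%:R <= 2 * z.
Proof.
elim: n a b => [|n IH] a b a0 a2 z0 bz; first by rewrite big_ord0 mulr_ge0.
rewrite big_ord_recl/=; have [b0|_] := boolP (b 0%N); last first.
  by rewrite mulr0 add0r (IH (fun k => a k.+1) (fun k => b k.+1))// => k; exact: bz.
rewrite mulr1; have az := bz _ b0.
have : \sum_(k < n) a (lift ord0 k) * (b (lift ord0 k))%:R <= \sum_(k < n) a k.+1.
  by apply: ler_sum => k _; case: (b _); rewrite ?mulr1// mulr0.
by have := lacunary_decr_sum n a2; have := a0 n; lra.
Qed.

Lemma ler_powR2r (R : realType) (s a b : R) : 0 <= s -> 0 <= a -> a <= b ->
  a `^ s <= b `^ s.
Proof.
move=> s0 a0 ab; apply: (ge0_ler_powR s0) => //; rewrite nnegrE//.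
exact: le_trans ab.
Qed.

Lemma ler_powR_neg (R : realType) (s a b : R) : s <= 0 -> 0 < a -> a <= b ->
  b `^ s <= a `^ s.
Proof.
move=> s0 a0 ab; have b0 := lt_le_trans a0 ab.
rewrite -(opprK s) (powRN b) (powRN a) lef_pV2 ?posrE ?powR_gt0//.
by rewrite ler_powR2r ?oppr_ge0 ?(ltW a0).
Qed.

Lemma powR_subadd (R : realType) (r a b : R) : 0 < r -> r <= 1 ->
  0 <= a -> 0 <= b -> (a + b) `^ r <= a `^ r + b `^ r.
Proof.
move=> r0 r1; rewrite le_eqVlt => /predU1P[<-|a0].
  by rewrite !add0r lerDr powR_ge0.
rewrite le_eqVlt => /predU1P[<-|b0]; first by rewrite !addr0 lerDl powR_ge0.
have key c : 0 < c -> c <= a + b -> c * (a + b) `^ (r - 1) <= c `^ r.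
  move=> c0 cab; rewrite -(mulr_powRB1 (ltW c0) r0) ler_wpM2l ?(ltW c0)//.
  by rewrite ler_powR_neg// subr_le0.
rewrite -(mulr_powRB1 _ r0) ?addr_ge0 ?(ltW a0) ?(ltW b0)// mulrDl.
by apply: lerD; apply: key => //; rewrite ?lerDl ?lerDr ltW.
Qed.

Lemma powR_sum_subadd (R : realType) (r : R) (a : nat -> R) (n : nat) :
  0 < r -> r <= 1 -> (forall k, 0 <= a k) ->
  (\sum_(k < n) a k) `^ r <= \sum_(k < n) a k `^ r.
Proof.
move=> r0 r1 a0; elim: n => [|n IH]; first by rewrite !big_ord0 powR0// gt_eqF.
rewrite !big_ord_recr/= (le_trans (powR_subadd r0 r1 _ _))//; last by rewrite lerD2r.
exact: sumr_ge0.
Qed.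

Lemma powR_exprn (R : realType) (a s : R) (n : nat) : 0 <= a ->
  (a ^+ n) `^ s = (a `^ s) ^+ n.
Proof.
move=> a0; elim: n => [|n IH]; first by rewrite !expr0 powR1.
by rewrite !exprS powRM ?exprn_ge0// IH.
Qed.

Lemma powR2_opp_lt1 (R : realType) (r : R) : 0 < r -> (2 : R) `^ (- r) < 1.
Proof.
move=> r0; rewrite powRN invf_lt1 ?powR_gt0//.
have {1}<- : (1 : R) `^ r = 1 by rewrite powR1.
by apply: gt0_ltr_powR; rewrite ?nnegrE// ltr1n.
Qed.

Lemma poweR_le (R : realType) (z : \bar R) (s q : R) : 0 <= q ->
  (0 <= z)%E -> 0 <= s -> (z <= s%:E)%E -> (z `^ q <= (s `^ q)%:E)%E.
Proof.
move=> q0 z0 s0 zs; rewrite -poweR_EFin; apply: gt0_ler_poweR => //;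
  by rewrite in_itv/= ?leey ?andbT ?lee_fin.
Qed.

Lemma poweR_ge (R : realType) (z : \bar R) (s q : R) : 0 <= q ->
  0 <= s -> (s%:E <= z)%E -> ((s `^ q)%:E <= z `^ q)%E.
Proof.
move=> q0 s0 zs; rewrite -poweR_EFin; apply: gt0_ler_poweR => //;
  by rewrite in_itv/= ?leey ?andbT ?lee_fin// (le_trans _ zs)// lee_fin.
Qed.

(** The partial sum is at most twice its last nonzero term, so its power is
already bounded by the corresponding single term on the right. *)
Lemma lacunary_powR_sum (R : realType) (q : R) (c : nat -> R) (b : nat -> bool)
    (n : nat) : 0 < q -> (forall k, 0 <= c k) -> (forall k, 2 * c k <= c k.+1) ->
  (\sum_(k < n) c k * (b k)%:R) `^ q <= \sum_(k < n) (2 * c k) `^ q * (b k)%:R.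
Proof.
move=> q0 c0 c2; elim: n => [|n IH]; first by rewrite !big_ord0 powR0// gt_eqF.
rewrite !big_ord_recr/=; case: (b n); last by rewrite !mulr0 !addr0.
rewrite !mulr1 (@le_trans _ _ ((2 * c n) `^ q))//; last first.
  by rewrite lerDr sumr_ge0// => k _; rewrite mulr_ge0 ?powR_ge0.
rewrite ler_powR2r ?(ltW q0) ?addr_ge0 ?sumr_ge0// => [k _|]; first by rewrite mulr_ge0.
rewrite mulr2n mulrDl !mul1r lerD2r; apply: le_trans (lacunary_sum n c0 c2).
by apply: ler_sum => k _; case: (b k); rewrite ?mulr1// mulr0.
Qed.

Lemma lacunary_powR_opp (R : realType) (p : R) (c : nat -> R) : 1 <= p ->
  (forall k, 0 < c k) -> (forall k, 2 * c k <= c k.+1) ->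
  forall k, 2 * c k.+1 `^ (- p) <= c k `^ (- p).
Proof.
move=> p1 c0 c2 k; have p0 : 0 < p by exact: lt_le_trans p1.
apply: (@le_trans _ _ (2 * (2 * c k) `^ (- p))).
  by rewrite ler_wpM2l// ler_powR_neg ?oppr_le0 ?(ltW p0)// mulr_gt0.
rewrite powRM ?(ltW (c0 k))// mulrA ler_piMl ?powR_ge0// powRN.
by rewrite ler_pdivrMr ?powR_gt0// mul1r le1r_powR// ler1n.
Qed.

(** The normalization that gives each bump of height [c] on a set of measure
c^(-p) the same size, whatever [c] is. *)
Lemma bump_normalized (R : realType) (p q c : R) : 0 < p -> 0 < c ->
  c `^ q * (c `^ (- p)) `^ (q / p) = 1.
Proof.
move=> p0 c0; rewrite -powRrM -powRD; last by rewrite (gt_eqF c0) implybT.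
rewrite (_ : q + - p * (q / p) = 0) ?powRr0//.
by field; rewrite gt_eqF.
Qed.

Lemma norm_le_powR (R : realType) (p u y : R) : 1 <= p -> 0 < u -> u <= `|y| ->
  `|y| <= u `^ (1 - p) * `|y| `^ p.
Proof.
move=> p1 u0 uy; have y0 : 0 < `|y| by exact: lt_le_trans uy.
have {1}-> : `|y| = `|y| `^ (1 - p) * `|y| `^ p.
  by rewrite -powRD ?subrK ?powRr1// (gt_eqF y0) implybT.
by rewrite ler_wpM2r ?powR_ge0// ler_powR_neg// subr_le0.
Qed.

(** Weak nullity of the bumps and the failure of the p-BS property are both obtained
from this contradiction between growth rates. *)
Lemma powR_growth_contra (R : realType) (a b e D : R) : a < b -> 0 < e ->
  (forall n, (0 < n)%N -> e * n%:R `^ b <= D * n%:R `^ a) -> False.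
Proof.
move=> ab e0 H; have ba : 0 < b - a by rewrite subr_gt0.
have D0 : 0 <= D.
  have := H 1%N isT; rewrite !powR1 !mulr1; apply: le_trans; exact: ltW.
(* the inequality bounds n^(b-a), hence n, by a fixed number *)
pose n := (Num.bound ((D / e) `^ (b - a)^-1)).+1.
have nR : 0 < n%:R :> R by rewrite ltr0n.
have : n%:R `^ (b - a) <= D / e.
  rewrite ler_pdivlMr// -(ler_pM2r (powR_gt0 a nR)).
  rewrite mulrAC -powRD ?subrK; first by rewrite mulrC; exact: H.
  by rewrite (gt_eqF nR) implybT.
move=> /(ler_powR2r (s := (b - a)^-1)).
rewrite invr_ge0 (ltW ba) powR_ge0 => /(_ isT isT).
rewrite -powRrM divff ?gt_eqF// powRr1 ?(ltW nR)//.
apply/negP; rewrite -ltNge (@lt_le_trans _ _ (n.-1)%:R)//.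
  by apply: archi_boundP; exact: powR_ge0.
by rewrite ler_nat.
Qed.

Lemma geometric_sum_le (R : realFieldType) (z : R) (n : nat) :
  0 <= z -> z < 1 -> \sum_(k < n) z ^+ k <= (1 - z)^-1.
Proof.
move=> z0 z1; have z1' : 0 < 1 - z by rewrite subr_gt0.
have := subrX1 z n; set s := (\sum_(i < n) _) => sE.
have zn : 0 <= z ^+ n by exact: exprn_ge0.
by rewrite -[leRHS]mul1r ler_pdivlMr//; nra.
Qed.

(** Summing the recurrence gives sum H <= H 0 + theta * sum H + E. *)
Lemma sum_contraction (R : realFieldType) (H e : nat -> R) (theta E : R) (n : nat) :
  0 <= theta -> theta < 1 -> (forall k, 0 <= H k) ->
  (forall k, H k.+1 <= theta * H k + e k) ->
  (forall m, \sum_(k < m) e k <= E) ->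
  \sum_(k < n) H k <= (H 0%N + E) / (1 - theta).
Proof.
move=> th0 th1 H0 He eE.
have SE (f : nat -> R) j : \sum_(k < j.+1) f k = \sum_(k < j) f k + f j.
  by rewrite big_ord_recr.
have step m : \sum_(k < m.+1) H k <=
    H 0%N + theta * (\sum_(k < m) H k) + \sum_(k < m) e k.
  elim: m => [|m IH]; first by rewrite big_ord_recl !big_ord0 mulr0 !addr0.
  rewrite (SE H m.+1) (SE e m); have := He m.
  have := congr1 ( *%R theta) (SE H m); rewrite mulrDr; lra.
rewrite ler_pdivlMr ?subr_gt0//.
have := step n; have := eE n; have := H0 n; rewrite SE; lra.
Qed.

Lemma nneseries_le_real (R : realType) (f : nat -> R) (B : R) :
  (forall k, 0 <= f k) -> (forall n, \sum_(k < n) f k <= B) ->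
  (\sum_(0 <= k <oo) (f k)%:E <= B%:E)%E.
Proof.
move=> f0 fB; apply: lime_le.
  by apply: is_cvg_nneseries => k _ _; rewrite lee_fin.
by apply: nearW => n; rewrite sumEFin lee_fin big_mkord.
Qed.

Lemma le_fineK (R : realType) (z : \bar R) : z \is a fin_num ->
  (z <= (fine z)%:E)%E.
Proof. by move=> zfin; rewrite fineK. Qed.

(** * The weight t^(r-1) on the unit interval *)

Lemma measurable_indicator_lt (R : realType) (d : R) :
  measurable_fun setT (fun t : R => (t < d)%R%:R : R).
Proof.
rewrite (_ : (fun t => _) = \1_(`]-oo, d[%classic : set R)).
  exact: measurable_indic.
by apply/funext => t; rewrite indicE; congr (_%:R); rewrite mem_setE in_itv/=.
Qed.

Lemma integral_indicator_lt (R : realType) (d : R) : 0 <= d -> d <= 1 ->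
  (\int[lebesgue_measure]_(t in `]0%R, 1%R[) ((t < d)%R%:R : R)%:E = d%:E)%E.
Proof.
move=> d0 d1.
transitivity (\int[lebesgue_measure]_(t in `]0%R, 1%R[)
    (\1_(`]-oo, d[%classic : set R) t)%:E)%E.
  by apply: eq_integral => t _; rewrite indicE mem_setE in_itv.
rewrite integral_indic//.
have -> : `]-oo, d[ `&` `]0, 1[ = (`]0, d[%classic : set R).
  apply/seteqP; split => t /=; rewrite !in_itv/=.
    by move=> [td /andP[-> _]].
  by move=> /andP[-> td]; split => //=; exact: lt_le_trans d1.
transitivity (lebesgue_measure (`]0, d[%classic : set R)); first by [].
rewrite lebesgue_measure_itv/= lte_fin; case: ltrP => [_|d0'].
  by rewrite oppr0 addr0.
by congr _%:E; apply/eqP; rewrite eq_le d0 d0'.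
Qed.

Lemma integral_powR_ge (R : realType) (r d : R) : 0 < r -> r <= 1 ->
  0 <= d -> d <= 1 ->
  ((d `^ r)%:E <= \int[lebesgue_measure]_(t in `]0%R, 1%R[)
     ((t < d)%R%:R * t `^ (r - 1))%:E)%E.
Proof.
move=> r0 r1 d0 d1.
have := d0; rewrite le_eqVlt => /predU1P[<-|dpos].
  by rewrite powR0 ?gt_eqF//; apply: integral_ge0 => t _; rewrite lee_fin mulr_ge0 ?powR_ge0.
rewrite -(mulr_powRB1 d0 r0) EFinM -(integral_indicator_lt d0 d1).
rewrite -ge0_integralZr//; last 2 first.
- by apply/measurable_EFinP; apply: measurable_funTS; exact: measurable_indicator_lt.
- by rewrite lee_fin powR_ge0.
apply: ge0_le_integral => //.
- by move=> t _; rewrite -EFinM lee_fin mulr_ge0 ?powR_ge0.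
- apply/measurable_EFinP; apply: measurable_funTS; apply: measurable_funM => //.
  exact: measurable_indicator_lt.
- apply/measurable_EFinP; apply: measurable_funTS; apply: measurable_funM => //.
  exact: measurable_indicator_lt.
move=> t /=; rewrite in_itv/= => /andP[t0 t1]; rewrite -EFinM lee_fin.
case: ltP => td; last by rewrite !mul0r.
by rewrite !mul1r ler_powR_neg// ?subr_le0// ltW.
Qed.

(** On the dyadic block d/2^(i+1) <= t < d/2^i the decreasing weight is at most
its value at the left end point, so a series of indicators dominates it. *)
Lemma powR_dyadic (R : realType) (r d t : R) : 0 < r -> r <= 1 -> 0 < t ->
  (((t < d)%R%:R * t `^ (r - 1))%:E <=
   \sum_(0 <= i <oo) ((t < d / 2 ^+ i)%R%:R * (d / 2 ^+ i.+1) `^ (r - 1))%:E)%E.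
Proof.
move=> r0 r1 t0.
have [td|_] := ltP t d; last first.
  by rewrite mul0r; apply: nneseries_ge0 => i _ _; rewrite lee_fin mulr_ge0 ?powR_ge0.
have d0 : 0 < d by exact: lt_trans td.
have ex : exists i, d / 2 ^+ i.+1 <= t.
  have /archi_boundP := ltW (divr_gt0 d0 t0).
  set n := Num.bound _ => dtn; exists n.
  rewrite ler_pdivrMr ?exprn_gt0// mulrC -ler_pdivrMr//.
  apply: le_trans (ltW dtn) _; rewrite -natrX ler_nat.
  by rewrite ltnW// ltnW// ltn_expl.
case: (ex_minnP ex) => i it imin.
apply: le_trans (nneseries_lim_ge i.+1 _); last first.
  by move=> k _ _; rewrite lee_fin mulr_ge0 ?powR_ge0.
rewrite big_nat_recr//=.
have tdi : t < d / 2 ^+ i.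
  case: i imin {it} => [|i] imin; first by rewrite expr0 divr1.
  rewrite ltNge; apply/negP => /imin; by rewrite ltnn.
apply: le_trans (leeDr _ _); last first.
  by apply: sume_ge0 => k _; rewrite lee_fin mulr_ge0 ?powR_ge0.
rewrite tdi lee_fin !mul1r ler_powR_neg ?subr_le0//.
by rewrite divr_gt0// exprn_gt0.
Qed.

(** The sum of the geometric series obtained by integrating [powR_dyadic] term by
term for d = 1. *)
Definition integral_powR_const (R : realType) (r : R) : R :=
  2 `^ (1 - r) / (1 - 2 `^ (- r)).

Lemma integral_powR_const_ge0 (R : realType) (r : R) : 0 < r -> 0 <= integral_powR_const r.
Proof.
by move=> r0; rewrite divr_ge0 ?powR_ge0// subr_ge0 ltW// powR2_opp_lt1.
Qed.

Lemma integral_powR_le (R : realType) (r d : R) : 0 < r -> r <= 1 ->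
  0 <= d -> d <= 1 ->
  (\int[lebesgue_measure]_(t in `]0%R, 1%R[)
     ((t < d)%R%:R * t `^ (r - 1))%:E <= (integral_powR_const r * d `^ r)%:E)%E.
Proof.
move=> r0 r1 d0 d1.
pose f i t := ((t < d / 2 ^+ i)%R%:R * (d / 2 ^+ i.+1) `^ (r - 1))%:E : \bar R.
have f0 i t : (0 <= f i t)%E by rewrite lee_fin mulr_ge0 ?powR_ge0.
have mf i : measurable_fun (`]0%R, 1%R[%classic : set R) (f i).
  apply/measurable_EFinP; apply: measurable_funTS; apply: measurable_funM => //.
  exact: measurable_indicator_lt.
apply: (@le_trans _ _ (\int[lebesgue_measure]_(t in `]0%R, 1%R[)
    \sum_(0 <= i <oo) f i t)%E).
  apply: ge0_le_integral => //.
  - by move=> t _; rewrite lee_fin mulr_ge0 ?powR_ge0.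
  - apply/measurable_EFinP; apply: measurable_funTS; apply: measurable_funM => //.
    exact: measurable_indicator_lt.
  - by apply: ge0_emeasurable_sum => [k t _ _|k _]; [exact: f0|exact: mf].
  - by move=> t /=; rewrite in_itv/= => /andP[t0 _]; exact: powR_dyadic.
rewrite integral_nneseries//.
have d2 i : 0 <= d / 2 ^+ i by rewrite divr_ge0.
have fE i : (\int[lebesgue_measure]_(t in `]0%R, 1%R[) f i t =
    (2 `^ (1 - r) * d `^ r * (2 `^ (- r)) ^+ i)%:E)%E.
  under eq_integral do rewrite /f EFinM.
  rewrite ge0_integralZr//; last 2 first.
  - by apply/measurable_EFinP; apply: measurable_funTS; exact: measurable_indicator_lt.
  - by rewrite lee_fin powR_ge0.
  rewrite integral_indicator_lt//; last first.
    by rewrite ler_pdivrMr ?exprn_gt0// mul1r (le_trans d1)// exprn_ege1// ler1n.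
  rewrite -EFinM; congr EFin.
  have -> : d / 2 ^+ i = 2 * (d / 2 ^+ i.+1).
    by rewrite exprS; field; rewrite expf_neq0.
  rewrite -[LHS]mulrA mulr_powRB1// powRM ?invr_ge0 ?exprn_ge0// ?divr_ge0//.
  rewrite powRD ?pnatr_eq0 ?implybT// powRr1//.
  rewrite -exprVn powR_exprn ?invr_ge0// -powR_inv1// -powRrM mulN1r exprS.
  ring.
rewrite (eq_eseriesr (g := fun i => (2 `^ (1 - r) * d `^ r * (2 `^ (- r)) ^+ i)%:E));
  last by move=> i _; exact: fE.
apply: nneseries_le_real => [k|n].
  by rewrite !mulr_ge0 ?powR_ge0// exprn_ge0 ?powR_ge0.
rewrite -mulr_sumr /integral_powR_const [leRHS]mulrAC ler_wpM2l ?mulr_ge0 ?powR_ge0//.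
by rewrite geometric_sum_le ?powR_ge0 ?powR2_opp_lt1.
Qed.

(** * The Lorentz norm and bounds for the rearrangement by step functions *)

Lemma rearrangement_ge0 (R : realType) (x : R -> R) (t : R) :
  (0 <= rearrangement x t)%E.
Proof. by apply: le_ereal_inf_tmp => _ [s [s0 _] <-]; rewrite lee_fin. Qed.

Lemma rearrangement_nincr (R : realType) (x : R -> R) (t u : R) : t <= u ->
  (rearrangement x u <= rearrangement x t)%E.
Proof.
move=> tu; apply: ereal_inf_le_tmp => _ [s [s0 st] <-]; exists s => //.
by split => //; apply: le_trans st _; rewrite lee_fin.
Qed.

Lemma measurable_rearrangement (R : realType) (x : R -> R) :
  measurable_fun setT (rearrangement x).
Proof.
apply: (measurability (@ErealGenCInfty.G R)) => [|/= _ [_] [r] -> <-].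
  exact: ErealGenCInfty.measurableE.
rewrite setTI; apply: is_interval_measurable => s t/=.
rewrite !in_itv/= !andbT => fs ft u /andP[su ut].
by rewrite in_itv/= andbT (le_trans ft)// rearrangement_nincr.
Qed.

(** The q-th power of the Lorentz norm without its factor q/p; [r] stands for q/p. *)
Definition lorentz_int (R : realType) (q r : R) (x : R -> R) : \bar R :=
  (\int[lebesgue_measure]_(t in `]0%R, 1%R[)
     (rearrangement x t `^ q * (t `^ (r - 1))%:E))%E.

Lemma lorentz_int_ge0 (R : realType) (q r : R) (x : R -> R) :
  (0 <= lorentz_int q r x)%E.
Proof.
apply: integral_ge0 => t _.
by rewrite mule_ge0 ?poweR_ge0// lee_fin powR_ge0.
Qed.

Lemma lorentz_normE (R : realType) (p q : R) (x : R -> R) : 0 < p -> 0 < q ->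
  (lorentz_norm p q x = (q / p)%:E * lorentz_int q (q / p) x `^ q^-1)%E.
Proof.
move=> p0 q0; rewrite /lorentz_norm; congr (_ * (_ `^ _))%E.
apply: eq_integral => t; rewrite inE/= in_itv/= => /andP[t0 t1].
rewrite poweRM ?rearrangement_ge0// ?lee_fin ?powR_ge0// -muleA; congr (_ * _)%E.
rewrite poweR_EFin -EFinM; congr EFin.
rewrite -(powR_inv1 (ltW t0)) -powRrM -powRD; last by rewrite (gt_eqF t0) implybT.
by rewrite mulrC.
Qed.

Lemma measurable_lorentz_integrand (R : realType) (q r : R) (x : R -> R) (D : set R) :
  measurable_fun D
    (fun t => rearrangement x t `^ q * (t `^ (r - 1))%:E)%E.
Proof.
apply: measurable_funTS; apply: emeasurable_funM.
  exact: (measurableT_comp (measurable_poweR q) (measurable_rearrangement x)).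
by apply/measurable_EFinP; exact: measurable_powR.
Qed.

Lemma measurable_level (R : realType) (r d v : R) (D : set R) :
  measurable_fun D (fun t => (v * ((t < d)%R%:R * t `^ (r - 1)))%:E).
Proof.
apply: measurable_funTS; apply/measurable_EFinP; apply: measurable_funM => //.
apply: measurable_funM; first exact: measurable_indicator_lt.
exact: measurable_powR.
Qed.

(** A step-function majorant of x*^q is integrated term by term against the
weight. *)
Lemma lorentz_int_le (R : realType) (q r : R) (x : R -> R) (v d : nat -> R)
    (B : R) : 0 < r -> r <= 1 ->
  (forall k, 0 <= v k) -> (forall k, 0 <= d k) -> (forall k, d k <= 1) ->
  (forall t, 0 < t -> t < 1 -> (rearrangement x t `^ q <=
      \sum_(0 <= k <oo) (v k * (t < d k)%R%:R)%:E)%E) ->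
  (forall n, \sum_(k < n) v k * d k `^ r <= B) ->
  (lorentz_int q r x <= (integral_powR_const r * B)%:E)%E.
Proof.
move=> r0 r1 v0 d0 d1 xv vB.
pose f k t := (v k * ((t < d k)%R%:R * t `^ (r - 1)))%:E : \bar R.
have f0 k t : (0 <= f k t)%E by rewrite lee_fin !mulr_ge0 ?powR_ge0.
apply: (@le_trans _ _ (\int[lebesgue_measure]_(t in `]0%R, 1%R[)
    \sum_(0 <= k <oo) f k t)%E).
  apply: ge0_le_integral => //.
  - by move=> t _; rewrite mule_ge0 ?poweR_ge0// lee_fin powR_ge0.
  - exact: measurable_lorentz_integrand.
  - by apply: ge0_emeasurable_sum => [k t _ _|k _]; [exact: f0|exact: measurable_level].
  move=> t /=; rewrite in_itv/= => /andP[t0 t1].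
  rewrite (eq_eseriesr (g := fun k => ((t `^ (r - 1))%:E * (v k * (t < d k)%R%:R)%:E)%E));
    last by move=> k _; rewrite /f -EFinM mulrA mulrC.
  rewrite nneseriesZl; last by move=> k _; rewrite lee_fin mulr_ge0.
  by rewrite muleC lee_wpmul2l ?xv// lee_fin powR_ge0.
rewrite integral_nneseries//; last by move=> k; exact: measurable_level.
apply: (@le_trans _ _ (\sum_(0 <= k <oo) (v k * (integral_powR_const r * d k `^ r))%:E)%E).
  apply: lee_nneseries => [k _ _|k _]; first exact: integral_ge0.
  under eq_integral do rewrite /f EFinM.
  rewrite ge0_integralZl//; first by rewrite EFinM lee_wpmul2l ?lee_fin// integral_powR_le.
  - apply/measurable_EFinP; apply: measurable_funTS; apply: measurable_funM => //.
    exact: measurable_indicator_lt.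
  - by move=> t _; rewrite lee_fin mulr_ge0 ?powR_ge0.
  - by rewrite lee_fin.
apply: nneseries_le_real => [k|n].
  by apply: mulr_ge0 => //; apply: mulr_ge0; [exact: integral_powR_const_ge0|exact: powR_ge0].
under eq_bigr do rewrite mulrCA.
by rewrite -mulr_sumr ler_wpM2l ?integral_powR_const_ge0.
Qed.

(** Counterpart of [lorentz_int_le] for a step-function minorant of x*^q. *)
Lemma lorentz_int_ge (R : realType) (q r : R) (x : R -> R) (v d : nat -> R)
    (n : nat) (K : R) : 0 < r -> r <= 1 -> 0 <= K ->
  (forall k, 0 <= v k) -> (forall k, 0 <= d k) -> (forall k, d k <= 1) ->
  (forall t, 0 < t -> t < 1 ->
     ((\sum_(k < n) v k * (t < d k)%R%:R)%:E <= K%:E * rearrangement x t `^ q)%E) ->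
  ((\sum_(k < n) v k * d k `^ r)%:E <= K%:E * lorentz_int q r x)%E.
Proof.
move=> r0 r1 K0 v0 d0 d1 xv.
rewrite -ge0_integralZl//; last 2 first.
- exact: measurable_lorentz_integrand.
- by move=> t _; rewrite mule_ge0 ?poweR_ge0// lee_fin powR_ge0.
pose f k t := (v k * ((t < d k)%R%:R * t `^ (r - 1)))%:E : \bar R.
have f0 k t : (0 <= f k t)%E by rewrite lee_fin !mulr_ge0 ?powR_ge0.
apply: (@le_trans _ _ (\int[lebesgue_measure]_(t in `]0%R, 1%R[)
    \sum_(k < n) f k t)%E); last first.
  apply: ge0_le_integral => //.
  - by move=> t _; apply: sume_ge0.
  - by apply: emeasurable_sum => k; exact: measurable_level.
  - by apply: measurable_funeM; exact: measurable_lorentz_integrand.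
  move=> t /=; rewrite in_itv/= => /andP[t0 t1].
  rewrite muleA (le_trans _ (lee_wpmul2r _ (xv _ t0 t1)))//.
  + by rewrite sumEFin -EFinM lee_fin mulr_suml; under eq_bigr do rewrite mulrA.
  + by rewrite lee_fin powR_ge0.
rewrite ge0_integral_sum//; last by move=> k; exact: measurable_level.
rewrite -sumEFin; apply: lee_sum => k _.
under eq_integral do rewrite /f EFinM.
rewrite ge0_integralZl//; first by rewrite EFinM lee_wpmul2l ?lee_fin// integral_powR_ge.
- apply/measurable_EFinP; apply: measurable_funTS; apply: measurable_funM => //.
  exact: measurable_indicator_lt.
- by move=> t _; rewrite lee_fin mulr_ge0 ?powR_ge0.
- by rewrite lee_fin.
Qed.

Lemma lorentz_int_fin_num (R : realType) (p q : R) (x : R -> R) : 0 < p -> 0 < q ->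
  (lorentz_norm p q x < +oo)%E -> lorentz_int q (q / p) x \is a fin_num.
Proof.
move=> p0 q0; rewrite lorentz_normE// => Nx.
rewrite ge0_fin_numE ?lorentz_int_ge0//.
apply: (@lty_poweRy _ _ q^-1); first by rewrite invr_eq0 gt_eqF.
rewrite ltNge leye_eq; apply/negP => /eqP Iy.
by move: Nx; rewrite Iy gt0_muley// lte_fin divr_gt0.
Qed.

Lemma lorentz_norm_le (R : realType) (p q B : R) (x : R -> R) : 0 < p -> 0 < q ->
  0 <= B -> (lorentz_int q (q / p) x <= B%:E)%E ->
  (lorentz_norm p q x <= (q / p * B `^ q^-1)%:E)%E.
Proof.
move=> p0 q0 B0 IB; rewrite lorentz_normE// [leRHS]EFinM; apply: lee_wpmul2l.
  by rewrite lee_fin divr_ge0 ?ltW.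
by apply: poweR_le; rewrite ?invr_ge0 ?(ltW q0) ?lorentz_int_ge0.
Qed.

Lemma lorentz_norm_ge (R : realType) (p q B : R) (x : R -> R) : 0 < p -> 0 < q ->
  0 <= B -> (B%:E <= lorentz_int q (q / p) x)%E ->
  ((q / p * B `^ q^-1)%:E <= lorentz_norm p q x)%E.
Proof.
move=> p0 q0 B0 IB; rewrite lorentz_normE// [leLHS]EFinM; apply: lee_wpmul2l.
  by rewrite lee_fin divr_ge0 ?ltW.
by apply: poweR_ge; rewrite ?invr_ge0 ?(ltW q0).
Qed.

(** * Lebesgue measure on the unit interval as a probability *)

(** A second name for [leb01], to which the structure of a probability on the Borel
sets of the line is attached. *)
Definition mu01 (R : realType) : set R -> \bar R := @leb01 R.

Lemma mu01_0 (R : realType) : mu01 (set0 : set R) = 0%E.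
Proof. exact: (measure0 (mrestr (@lebesgue_measure R) (measurable_itv `[0%R, 1%R]))). Qed.

Lemma mu01_ge0 (R : realType) (A : set R) : (0 <= mu01 A)%E.
Proof. exact: (measure_ge0 (mrestr (@lebesgue_measure R) (measurable_itv `[0%R, 1%R]))). Qed.

Lemma mu01_sigma_additive (R : realType) : semi_sigma_additive (@mu01 R).
Proof.
exact: (@measure_semi_sigma_additive _ _ _
  (mrestr (@lebesgue_measure R) (measurable_itv `[0%R, 1%R]))).
Qed.

HB.instance Definition _ (R : realType) := isMeasure.Build _ _ _ (@mu01 R)
  (@mu01_0 R) (@mu01_ge0 R) (@mu01_sigma_additive R).

Lemma mu01_setT (R : realType) : mu01 (R := R) setT = 1%E.
Proof.
rewrite /mu01 /leb01/= /mrestr setTI.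
transitivity (lebesgue_measure (`[0, 1]%classic : set R)); first by [].
by rewrite lebesgue_measure_itv/= lte_fin ltr01 oppr0 adde0.
Qed.

HB.instance Definition _ (R : realType) :=
  Measure_isProbability.Build _ _ _ (@mu01 R) (mu01_setT R).

Lemma leb01_congr (R : realType) (A B : set R) :
  (forall u, u \in `[0, 1] -> (A u <-> B u)) -> leb01 A = leb01 B.
Proof.
move=> AB; rewrite /leb01 /mrestr; congr lebesgue_measure.
by apply/seteqP; split => u [Au u01]; split => //; apply/(AB u).
Qed.

Lemma rearrangement_congr (R : realType) (x y : R -> R) :
  {in `[0, 1], x =1 y} -> rearrangement x = rearrangement y.
Proof.
move=> xy; apply/funext => t; rewrite /rearrangement; congr ereal_inf.
congr (_ @` _); apply/seteqP; split => s [s0 st]; split => //;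
  rewrite (le_trans _ st)// le_eqVlt; apply/orP; left; apply/eqP;
  by apply: leb01_congr => u u01; rewrite /= xy.
Qed.

Lemma lorentz_norm_congr (R : realType) (p q : R) (x y : R -> R) :
  {in `[0, 1], x =1 y} -> lorentz_norm p q x = lorentz_norm p q y.
Proof. by move=> xy; rewrite /lorentz_norm (rearrangement_congr xy). Qed.

Lemma measurable_gt_norm d (T : measurableType d) (R : realType)
    (x : T -> R) (s : R) :
  measurable_fun setT x -> measurable [set u | s < `|x u|].
Proof.
move=> mx; have mnx : measurable_fun setT (fun u => `|x u|) by exact: measurableT_comp.
have := mnx measurableT `]s, +oo[%classic (measurable_itv _).
rewrite setTI; congr measurable; apply/seteqP; split => u /=;
  by rewrite in_itv/= andbT.
Qed.

(** The rearrangement depends on the distribution only, hence so does the norm. *)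
Lemma rearrangement_same_law (R : realType) (x y : R -> R) :
  (forall B, measurable B -> mu01 (x @^-1` B) = mu01 (y @^-1` B)) ->
  rearrangement x = rearrangement y.
Proof.
move=> xy; apply/funext => t; rewrite /rearrangement; congr ereal_inf.
congr (_ @` _); apply/funext => s.
have := xy _ (measurable_gt_norm s (@measurable_id _ _ setT)).
by rewrite /mu01 /preimage /= => ->.
Qed.

(** * Lorentz norm and distribution function *)

Definition tail (R : realType) (x : R -> R) (s : R) : R :=
  fine (mu01 [set u | s < `|x u|]).

Lemma tailE (R : realType) (x : R -> R) (s : R) : measurable_fun setT x ->
  mu01 [set u | s < `|x u|] = (tail x s)%:E.
Proof.
move=> mx; rewrite /tail fineK//; apply: fin_num_measure.
exact: measurable_gt_norm.
Qed.

Lemma tail_ge0 (R : realType) (x : R -> R) (s : R) : 0 <= tail x s.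
Proof. by rewrite /tail fine_ge0. Qed.

Lemma tail_le1 (R : realType) (x : R -> R) (s : R) : measurable_fun setT x ->
  tail x s <= 1.
Proof.
move=> mx; rewrite -lee_fin -tailE//; apply: probability_le1.
exact: measurable_gt_norm.
Qed.

Lemma tail_nincr (R : realType) (x : R -> R) (s s' : R) : measurable_fun setT x ->
  s <= s' -> tail x s' <= tail x s.
Proof.
move=> mx ss'; rewrite -lee_fin -!tailE//; apply: le_measure.
- by rewrite inE; exact: measurable_gt_norm.
- by rewrite inE; exact: measurable_gt_norm.
- by move=> u /=; exact: le_lt_trans.
Qed.

Lemma rearrangement_le (R : realType) (x : R -> R) (s t : R) :
  measurable_fun setT x -> 0 <= s -> tail x s <= t ->
  (rearrangement x t <= s%:E)%E.
Proof.
move=> mx s0 st; apply: ereal_inf_lbound; exists s => //.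
by split => //; rewrite -[leb01 _]/(mu01 _) tailE// lee_fin.
Qed.

Lemma dyadic_level_gt0 (R : realType) (M : R) (k : nat) : 0 < M -> 0 < M * 2 ^+ k.
Proof. by move=> M0; rewrite mulr_gt0// exprn_gt0. Qed.

(** If x*(t) lies between consecutive levels M 2^k and M 2^(k+1), then t is smaller
than the tail at M 2^k, so the term of that index dominates x*(t)^q; the term
M^q takes care of x*(t) <= M. If x*(t) is infinite, every index contributes and
the series diverges. *)
Lemma lorentz_int_le_dyadic (R : realType) (q r : R) (x : R -> R) (M B : R) :
  0 < q -> 0 < r -> r <= 1 -> 0 < M -> measurable_fun setT x ->
  (forall n, M `^ q + \sum_(k < n) (M * 2 ^+ k.+1) `^ q *
     tail x (M * 2 ^+ k) `^ r <= B) ->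
  (lorentz_int q r x <= (integral_powR_const r * B)%:E)%E.
Proof.
move=> q0 r0 r1 M0 mx xB.
(* shifted by one, so that index 0 carries the constant term M^q *)
pose d k := if k is k'.+1 then tail x (M * 2 ^+ k') else 1.
have d0 k : 0 <= d k by case: k => //= k; exact: tail_ge0.
apply: (@lorentz_int_le _ _ _ _ (fun k => (M * 2 ^+ k) `^ q) d) => //.
- by move=> k; exact: powR_ge0.
- by case=> //= k; exact: tail_le1.
- move=> t t0 t1; set S := (\sum_(0 <= k <oo) _)%E.
  have S_ge k : t < d k -> (((M * 2 ^+ k) `^ q)%:E <= S)%E.
    move=> tdk; apply: le_trans (nneseries_lim_ge k.+1 _); last first.
      by move=> i _ _; rewrite lee_fin mulr_ge0 ?powR_ge0.
    rewrite big_nat_recr//= tdk mulr1; apply: leeDr.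
    by apply: sume_ge0 => i _; rewrite lee_fin mulr_ge0 ?powR_ge0.
  have [[k xk]|noubound] := pselect (exists k, (rearrangement x t <= (M * 2 ^+ k)%:E)%E).
    have exk : exists k, (rearrangement x t <= (M * 2 ^+ k)%:E)%E by exists k.
    case: (ex_minnP exk) => m xm mmin.
    apply: le_trans (S_ge m _).
      by apply: poweR_le; rewrite ?rearrangement_ge0 ?(ltW q0)// ltW// dyadic_level_gt0.
    case: m mmin {xm} => //= m mmin; rewrite ltNge; apply/negP => tm.
    have /mmin : (rearrangement x t <= (M * 2 ^+ m)%:E)%E.
      by apply: rearrangement_le => //; rewrite ltW// dyadic_level_gt0.
    by rewrite ltnn.
  (* here x* t is infinite *)
  suff -> : S = +oo%E by rewrite leey.
  apply/eqyP => A A0.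
  have td k : t < d k.
    case: k => //= k; rewrite ltNge; apply/negP => tk; apply: noubound; exists k.
    by apply: rearrangement_le => //; rewrite ltW// dyadic_level_gt0.
  pose k := Num.bound (A `^ q^-1 / M).
  apply: le_trans (S_ge k (td k)); rewrite lee_fin.
  have {1}-> : A = (A `^ q^-1) `^ q by rewrite -powRrM mulVf ?gt_eqF// powRr1// ltW.
  apply: ler_powR2r; rewrite ?powR_ge0 ?(ltW q0)// mulrC -ler_pdivrMr//.
  apply: le_trans (ltW (archi_boundP _)) _; first by rewrite divr_ge0 ?powR_ge0 ?ltW.
  by rewrite -natrX ler_nat ltnW// ltn_expl.
- case=> [|n]; first by rewrite big_ord0; have := xB 0%N; rewrite big_ord0 addr0;
    apply: le_trans; exact: powR_ge0.
  rewrite big_ord_recl/= expr0 mulr1 powR1 mulr1.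
  exact: xB.
Qed.

(** If t < d_k then x*(t) >= c_k; since the numbers c_k^q at least double, the sum
of those for which this happens is at most twice x*(t)^q. *)
Lemma lorentz_int_ge_lacunary (R : realType) (q r : R) (x : R -> R)
    (c d : nat -> R) (n : nat) :
  1 <= q -> 0 < r -> r <= 1 -> measurable_fun setT x ->
  (forall k, 0 <= c k) -> (forall k, 2 * c k <= c k.+1) ->
  (forall k, 0 <= d k) -> (forall k, d k <= 1) ->
  (forall k s, (k < n)%N -> 0 <= s -> s < c k -> d k <= tail x s) ->
  ((\sum_(k < n) c k `^ q * d k `^ r)%:E <= 2%:E * lorentz_int q r x)%E.
Proof.
move=> q1 r0 r1 mx c0 c2 d0 d1 dx; have q0 : 0 < q by exact: lt_le_trans q1.
apply: (@lorentz_int_ge _ _ _ _ (fun k => c k `^ q) d) => // [k|t t0 t1]; first exact: powR_ge0.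
have [xtfin|] := boolP (rearrangement x t \is a fin_num); last first.
  rewrite ge0_fin_numE ?rearrangement_ge0// -leNgt leye_eq => /eqP ->.
  by rewrite poweRyr ?gt_eqF// gt0_muley ?leey// lte_fin.
rewrite -(fineK xtfin) poweR_EFin -EFinM lee_fin.
apply: (@lacunary_sum_max _ (fun k => c k `^ q) (fun k => t < d k)) => [k|k||k kn tdk].
- exact: powR_ge0.
- have q2 : (2 : R) <= 2 `^ q by rewrite le1r_powR// ler1n.
  rewrite (@le_trans _ _ (2 `^ q * c k `^ q)) ?ler_wpM2r ?powR_ge0//.
  by rewrite -powRM// ler_powR2r ?(ltW q0)// mulr_ge0.
- exact: powR_ge0.
apply: ler_powR2r => //; first exact: ltW.
rewrite -lee_fin fineK//; apply: le_ereal_inf_tmp => _ [s' [s'0 ss'] <-].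
rewrite lee_fin leNgt; apply/negP => s'c.
move: ss'; rewrite -[leb01 _]/(mu01 _) tailE// lee_fin leNgt.
by rewrite (lt_le_trans tdk)// dx.
Qed.

Lemma lorentz_int_ge_dyadic (R : realType) (q r : R) (x : R -> R) (M : R) (n : nat) :
  1 <= q -> 0 < r -> r <= 1 -> 0 < M -> measurable_fun setT x ->
  ((\sum_(k < n) (M * 2 ^+ k) `^ q * tail x (M * 2 ^+ k) `^ r)%:E <=
    2%:E * lorentz_int q r x)%E.
Proof.
move=> q1 r0 r1 M0 mx; apply: (@lorentz_int_ge_lacunary _ _ _ _ (fun k => M * 2 ^+ k)
  (fun k => tail x (M * 2 ^+ k))) => // [k|k|k|k|k s kn s0 sk].
- by rewrite ltW// dyadic_level_gt0.
- by rewrite exprS mulrCA.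
- exact: tail_ge0.
- exact: tail_le1.
- by rewrite tail_nincr// ltW.
Qed.

(** * Bounded random variables *)

(** Stable under the algebraic operations and always integrable for a probability,
which removes the integrability side conditions from the variance
computation. *)
Definition bounded_mfun d (T : measurableType d) (R : realType) (f : T -> R) :=
  measurable_fun setT f /\ exists C, forall t, `|f t| <= C.

Lemma bounded_mfunM d (T : measurableType d) (R : realType) (f g : T -> R) :
  bounded_mfun f -> bounded_mfun g -> bounded_mfun (fun t => f t * g t).
Proof.
move=> [mf [C fC]] [mg [D gD]]; split; first exact: measurable_funM.
by exists (C * D) => t; rewrite normrM ler_pM.
Qed.

Lemma bounded_mfunD d (T : measurableType d) (R : realType) (f g : T -> R) :
  bounded_mfun f -> bounded_mfun g -> bounded_mfun (fun t => f t + g t).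
Proof.
move=> [mf [C fC]] [mg [D gD]]; split; first exact: measurable_funD.
by exists (C + D) => t; rewrite (le_trans (ler_normD _ _))// lerD.
Qed.

Lemma bounded_mfun_cst d (T : measurableType d) (R : realType) (c : R) :
  bounded_mfun (fun _ : T => c).
Proof. by split; [exact: measurable_cst|exists `|c|]. Qed.

Lemma bounded_mfun_sum d (T : measurableType d) (R : realType)
    (f : nat -> T -> R) (n : nat) :
  (forall k, bounded_mfun (f k)) -> bounded_mfun (fun t => \sum_(k < n) f k t).
Proof.
move=> bf; elim: n => [|n IH].
  rewrite (_ : (fun _ => _) = fun=> 0); first exact: bounded_mfun_cst.
  by apply/funext => t; rewrite big_ord0.
rewrite (_ : (fun _ => _) = fun t => \sum_(k < n) f k t + f n t).
  exact: bounded_mfunD.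
by apply/funext => t; rewrite big_ord_recr.
Qed.

Lemma bounded_mfun_comp d (T : measurableType d) (R : realType) (phi : R -> R)
    (X : T -> R) :
  measurable_fun setT X -> bounded_mfun phi -> bounded_mfun (fun t => phi (X t)).
Proof.
by move=> mX [mphi [C phiC]]; split; [exact: (measurableT_comp mphi mX)|exists C].
Qed.

Lemma bounded_indic d (T : measurableType d) (R : realType) (A : set T) :
  measurable A -> bounded_mfun (\1_A : T -> R).
Proof.
move=> mA; split; first exact: measurable_indic.
by exists 1 => t; rewrite indicE ger0_norm// lern1 leq_b1.
Qed.

Lemma bounded_mfun_integrable d (T : measurableType d) (R : realType)
    (P : probability T R) (f : T -> R) :
  bounded_mfun f -> P.-integrable setT (EFin \o f).
Proof.
move=> [mf [C fC]]; apply: measurable_bounded_integrable => //.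
  by rewrite -ge0_fin_numE //; exact: fin_num_measure.
exists C; split; first exact: num_real.
by move=> M CM t _ /=; rewrite (le_trans (fC t))// ltW.
Qed.

Lemma Rintegral_sum d (T : measurableType d) (R : realType)
    (P : probability T R) (f : nat -> T -> R) (n : nat) :
  (forall k, bounded_mfun (f k)) ->
  \int[P]_t (\sum_(k < n) f k t) = \sum_(k < n) \int[P]_t (f k t).
Proof.
move=> bf; elim: n => [|n IH].
  by rewrite big_ord0; under eq_Rintegral do rewrite big_ord0; rewrite Rintegral_cst// mul0r.
rewrite big_ord_recr/= -IH -RintegralD//.
- by under eq_Rintegral do rewrite big_ord_recr.
- by apply: bounded_mfun_integrable; exact: bounded_mfun_sum.
- exact: bounded_mfun_integrable.
Qed.

Lemma Rintegral_probability_cst d (T : measurableType d) (R : realType)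
    (P : probability T R) (c : R) : \int[P]_t c = c.
Proof.
have PT : P setT = 1%E := probability_setT P.
by rewrite Rintegral_cst//= PT mulr1.
Qed.

Lemma fine_probabilityE d (T : measurableType d) (R : realType)
    (P : probability T R) (A : set T) : measurable A ->
  fine (P A) = \int[P]_t (\1_A t : R).
Proof. by move=> mA; rewrite /Rintegral integral_indic// setIT. Qed.

Lemma indicator_gt_normE (T : Type) (R : realType) (x : T -> R) (s : R) :
  (fun t => (s < `|x t|)%R%:R : R) = \1_[set t | s < `|x t|].
Proof. by apply/funext => t; rewrite indicE mem_setE. Qed.

(** * Moments of functions in the Lorentz space *)

Lemma measurable_indicator_gt_norm (R : realType) (x : R -> R) (s : R) :
  measurable_fun setT x ->
  measurable_fun setT (fun t => (s < `|x t|)%R%:R : R).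
Proof.
move=> mx; rewrite indicator_gt_normE; apply: measurable_indic.
exact: measurable_gt_norm.
Qed.

Lemma integral_indicator_gt_norm (R : realType) (x : R -> R) (s w : R) :
  measurable_fun setT x -> 0 <= w ->
  (\int[@mu01 R]_t (w * (s < `|x t|)%R%:R)%:E = (w * tail x s)%:E)%E.
Proof.
move=> mx w0; under eq_integral do rewrite EFinM.
rewrite ge0_integralZl//; last first.
  by apply/measurable_EFinP; exact: measurable_indicator_gt_norm.
rewrite EFinM -tailE//; congr (_ * _)%E.
transitivity (\int[@mu01 R]_t (\1_[set t | s < `|x t|] t)%:E)%E.
  by apply: eq_integral => t _; rewrite -indicator_gt_normE.
by rewrite integral_indic ?setIT//; exact: measurable_gt_norm.
Qed.

(** Only the term of the dyadic block containing [y] is needed. *)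
Lemma norm_powR_dyadic (R : realType) (p M y : R) : 0 <= p -> 0 < M -> 0 <= y ->
  ((y `^ p)%:E <= (M `^ p)%:E +
     \sum_(0 <= k <oo) ((M * 2 ^+ k.+1) `^ p * (M * 2 ^+ k < y)%R%:R)%:E)%E.
Proof.
move=> p0 M0 y0; pose f k : \bar R := ((M * 2 ^+ k.+1) `^ p * (M * 2 ^+ k < y)%R%:R)%:E.
have f0 k : (0 <= f k)%E by rewrite lee_fin mulr_ge0 ?powR_ge0.
have ex : exists k, y <= M * 2 ^+ k.
  exists (Num.bound (y / M)); rewrite mulrC -ler_pdivrMr//.
  rewrite (le_trans (ltW (archi_boundP _)))// ?divr_ge0 ?(ltW M0)//.
  by rewrite -natrX ler_nat ltnW// ltn_expl.
case: (ex_minnP ex) => -[|m] ym mmin.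
  rewrite (@le_trans _ _ (M `^ p)%:E)//.
    by rewrite lee_fin ler_powR2r//; move: ym; rewrite expr0 mulr1.
  by rewrite leeDl//; apply: nneseries_ge0 => k _ _; exact: f0.
apply: le_trans (leeDr _ _); last by rewrite lee_fin powR_ge0.
apply: le_trans (nneseries_lim_ge m.+1 _); last by move=> k _ _; exact: f0.
rewrite big_nat_recr//= (le_trans _ (leeDr _ _))//; last first.
  by apply: sume_ge0 => k _; exact: f0.
have -> : M * 2 ^+ m < y.
  by rewrite ltNge; apply/negP => /mmin; rewrite ltnn.
by rewrite mulr1 lee_fin ler_powR2r.
Qed.

(** The numbers a_k = 2^(kp) m(|x| > M 2^k) satisfy sum_k a_k^(q/p) <= 2 by
[lorentz_int_ge_dyadic]; as q/p <= 1, subadditivity of the power bounds sum_k a_k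
itself, and this sum controls the p-th moment. The scale [M] makes the estimate
homogeneous in [x]. *)
Lemma moment_le (R : realType) (p q : R) (x : R -> R) (M : R) :
  1 <= q -> q <= p -> 0 < M -> measurable_fun setT x ->
  (lorentz_int q (q / p) x <= (M `^ q)%:E)%E ->
  (\int[@mu01 R]_t (`|x t| `^ p)%:E <=
     ((1 + 2 `^ p * 2 `^ (p / q)) * M `^ p)%:E)%E.
Proof.
move=> q1 qp M0 mx IM.
have q0 : 0 < q by exact: lt_le_trans q1.
have p0 : 0 < p by exact: lt_le_trans qp.
have r0 : 0 < q / p by rewrite divr_gt0.
have r1 : q / p <= 1 by rewrite ler_pdivrMr// mul1r.
pose a k := (2 ^+ k) `^ p * tail x (M * 2 ^+ k).
have a0 k : 0 <= a k by rewrite mulr_ge0 ?powR_ge0 ?tail_ge0.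
have asum n : \sum_(k < n) a k <= 2 `^ (p / q).
  have : \sum_(k < n) (M * 2 ^+ k) `^ q * tail x (M * 2 ^+ k) `^ (q / p) <= 2 * M `^ q.
    rewrite -lee_fin; apply: le_trans (lorentz_int_ge_dyadic _ q1 r0 r1 M0 mx) _.
    by rewrite EFinM lee_wpmul2l// lee_fin.
  have -> : \sum_(k < n) (M * 2 ^+ k) `^ q * tail x (M * 2 ^+ k) `^ (q / p) =
      M `^ q * \sum_(k < n) a k `^ (q / p).
    rewrite mulr_sumr; apply: eq_bigr => k _.
    rewrite powRM ?exprn_ge0 ?(ltW M0)// powRM ?powR_ge0 ?tail_ge0//.
    by rewrite -powRrM (mulrC p) divfK ?gt_eqF// mulrA.
  rewrite mulrC ler_pM2r ?powR_gt0// => a2.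
  have S0 : 0 <= \sum_(k < n) a k by exact: sumr_ge0.
  have -> : \sum_(k < n) a k = (\sum_(k < n) a k) `^ ((q / p) * (p / q)).
    by rewrite mulrA divfK ?gt_eqF// divff ?gt_eqF// powRr1.
  rewrite powRrM ler_powR2r ?powR_ge0 ?divr_ge0 ?(ltW p0) ?(ltW q0)//.
  exact: le_trans (powR_sum_subadd _ r0 r1 a0) a2.
pose w k := (M * 2 ^+ k.+1) `^ p.
have w0 k : 0 <= w k by exact: powR_ge0.
have mw k : measurable_fun setT (fun t => (w k * (M * 2 ^+ k < `|x t|)%R%:R)%:E : \bar R).
  apply/measurable_EFinP; apply: measurable_funM => //.
  exact: measurable_indicator_gt_norm.
have wt0 k t : (0 <= (w k * (M * 2 ^+ k < `|x t|)%R%:R)%:E :> \bar R)%E.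
  by rewrite lee_fin mulr_ge0.
have mxp : measurable_fun setT (fun t => (`|x t| `^ p)%:E).
  apply/measurable_EFinP.
  have mnx : measurable_fun setT (fun u => `|x u|) by exact: measurableT_comp.
  exact: (measurableT_comp (measurable_powR _) mnx).
apply: (@le_trans _ _ (\int[@mu01 R]_t ((M `^ p)%:E +
   \sum_(0 <= k <oo) (w k * (M * 2 ^+ k < `|x t|)%R%:R)%:E))%E).
  apply: ge0_le_integral => //.
  - apply: emeasurable_funD => //.
    by apply: ge0_emeasurable_sum => [k t _ _|k _]; [exact: wt0|exact: mw].
  - by move=> t _; apply: norm_powR_dyadic => //; exact: ltW.
rewrite ge0_integralD//; last 3 first.
- by move=> t _; rewrite lee_fin powR_ge0.
- by move=> t _; apply: nneseries_ge0 => k _ _; exact: wt0.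
- by apply: ge0_emeasurable_sum => [k t _ _|k _]; [exact: wt0|exact: mw].
rewrite integral_cst// [X in (_ * X + _)%E](mu01_setT R) mule1 integral_nneseries//.
rewrite (eq_eseriesr (g := fun k => (w k * tail x (M * 2 ^+ k))%:E)); last first.
  by move=> k _; rewrite integral_indicator_gt_norm.
rewrite mulrDl mul1r EFinD leeD2l// nneseries_le_real// => [k|n].
  by rewrite mulr_ge0 ?tail_ge0.
have -> : \sum_(k < n) w k * tail x (M * 2 ^+ k) =
    2 `^ p * M `^ p * \sum_(k < n) a k.
  rewrite mulr_sumr; apply: eq_bigr => k _.
  rewrite /w /a exprS !powRM ?exprn_ge0// ?mulr_ge0 ?exprn_ge0 ?(ltW M0)//.
  ring.
by rewrite mulrAC ler_wpM2r ?powR_ge0// ler_wpM2l ?powR_ge0.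
Qed.

Lemma integrable_powR_of_lorentz (R : realType) (p q L : R) (x : R -> R) :
  1 <= q -> q <= p -> measurable_fun setT x ->
  (lorentz_int q (q / p) x <= L%:E)%E -> exists2 A : R, 0 < A &
  (@mu01 R).-integrable setT (fun t => (`|x t| `^ p)%:E) /\
  \int[@mu01 R]_t (`|x t| `^ p) <= A.
Proof.
move=> q1 qp mx IL; have q0 : 0 < q by exact: lt_le_trans q1.
have L0 : 0 <= L by rewrite -lee_fin (le_trans _ IL)// lorentz_int_ge0.
pose M := (L + 1) `^ q^-1.
have M0 : 0 < M by rewrite powR_gt0// ltr_wpDl.
have := @moment_le _ p q x M q1 qp M0 mx.
have -> : M `^ q = L + 1.
  by rewrite -powRrM mulVf ?gt_eqF// powRr1// addr_ge0.
move=> /(_ (le_trans IL _)); rewrite lee_fin lerDl ler01 => /(_ isT).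
set A := (X in (_ <= X%:E)%E) => IA; exists A.
  rewrite /A; apply: mulr_gt0; last exact: powR_gt0.
  by apply: ltr_wpDr => //; apply: mulr_ge0; exact: powR_ge0.
have mxp : measurable_fun setT (fun t => (`|x t| `^ p)%:E).
  apply/measurable_EFinP.
  have mnx : measurable_fun setT (fun u => `|x u|) by exact: measurableT_comp.
  exact: (measurableT_comp (measurable_powR _) mnx).
have ixp : (@mu01 R).-integrable setT (fun t => (`|x t| `^ p)%:E).
  apply/integrableP; split => //; apply: le_lt_trans (ltry A).
  apply: le_trans IA; rewrite le_eqVlt; apply/orP; left; apply/eqP.
  by apply: eq_integral => t _; rewrite gee0_abs// lee_fin powR_ge0.
split => //; rewrite /Rintegral -lee_fin fineK//.
exact: integrable_fin_num ixp.
Qed.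

Lemma integrable_of_powR (R : realType) (p : R) (x : R -> R) :
  1 <= p -> measurable_fun setT x ->
  (@mu01 R).-integrable setT (fun t => (`|x t| `^ p)%:E) ->
  (@mu01 R).-integrable setT (EFin \o x).
Proof.
move=> p1 mx ixp.
have i1 : (@mu01 R).-integrable setT (EFin \o (fun _ => 1 : R)).
  exact: (bounded_mfun_integrable _ (bounded_mfun_cst _ _)).
apply: (le_integrable _ _ _ (integrableD _ i1 ixp)) => //.
  exact/measurable_EFinP.
move=> t _; rewrite /= lee_fin [leRHS]ger0_norm ?addr_ge0 ?powR_ge0//.
have [x1|x1] := leP 1 `|x t|.
  have := norm_le_powR p1 ltr01 x1; rewrite powR1 mul1r => H.
  by rewrite (le_trans H)// lerDr.
by rewrite (le_trans (ltW x1))// lerDl powR_ge0.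
Qed.

(** Pointwise |x| <= M + M^(1-p) |x|^p, and the p-th moment is O(M^p) by
[moment_le]. *)
Lemma le_Rintegral_lorentz (R : realType) (p q M : R) (x : R -> R) :
  1 <= q -> q <= p -> 1 < p -> 0 < M -> measurable_fun setT x ->
  (lorentz_int q (q / p) x <= (M `^ q)%:E)%E ->
  (@mu01 R).-integrable setT (EFin \o x) /\
  `|\int[@mu01 R]_t x t| <= (1 + (1 + 2 `^ p * 2 `^ (p / q))) * M.
Proof.
move=> q1 qp p1 M0 mx IM.
have [A A0 [ixp _]] := integrable_powR_of_lorentz q1 qp mx IM.
have ix := integrable_of_powR (ltW p1) mx ixp; split => //.
apply: le_trans (le_normr_Rintegral _ ix) _ => //.
set K := 1 + 2 `^ p * _.
have IK : \int[@mu01 R]_t (`|x t| `^ p) <= K * M `^ p.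
  rewrite -lee_fin; apply: le_trans (moment_le q1 qp M0 mx IM).
  by rewrite /Rintegral fineK//; exact: integrable_fin_num ixp.
have ib1 : (@mu01 R).-integrable setT (EFin \o (fun _ => M : R)).
  exact: (bounded_mfun_integrable _ (bounded_mfun_cst _ _)).
have ib2 : (@mu01 R).-integrable setT (EFin \o (fun t => M `^ (1 - p) * `|x t| `^ p)).
  exact: (integrableZl measurableT _ ixp).
apply: (@le_trans _ _ (\int[@mu01 R]_t (M + M `^ (1 - p) * `|x t| `^ p))).
  apply: le_Rintegral => //.
  - exact: (integrable_abse ix).
  - exact: (integrableD measurableT ib1 ib2).
  move=> t _; have [xM|xM] := leP M `|x t|.
    by rewrite (le_trans (norm_le_powR (ltW p1) M0 xM))// lerDr ltW.
  by rewrite (le_trans (ltW xM))// lerDl mulr_ge0 ?powR_ge0.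
rewrite RintegralD// Rintegral_probability_cst RintegralZl// mulrDl mul1r lerD2l.
apply: le_trans (ler_wpM2l (powR_ge0 _ _) IK) _.
by rewrite mulrCA -powRD ?subrK ?powRr1 ?oner_eq0// ltW.
Qed.

(** * Chebyshev's inequality for uncorrelated variables *)

Lemma markov_square d (T : measurableType d) (R : realType)
    (P : probability T R) (W : T -> R) (u : R) : 0 < u -> bounded_mfun W ->
  fine (P [set t | u < `|W t|]) <= \int[P]_t (W t ^+ 2) / u ^+ 2.
Proof.
move=> u0 bW; have [mW _] := bW.
have mA : measurable [set t | u < `|W t|].
  have mnW : measurable_fun setT (fun t => `|W t|) by exact: measurableT_comp.
  have := mnW measurableT `]u, +oo[%classic (measurable_itv _).
  rewrite setTI; congr measurable; apply/seteqP; split => t /=;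
    by rewrite in_itv/= andbT.
have b1 : bounded_mfun (\1_[set t | u < `|W t|] : T -> R).
  split; first exact: measurable_indic.
  by exists 1 => t; rewrite indicE ger0_norm// lern1 leq_b1.
have u2 : 0 < u ^+ 2 by rewrite exprn_gt0.
rewrite ler_pdivlMr//.
have -> : fine (P [set t | u < `|W t|]) = \int[P]_t (\1_[set t | u < `|W t|] t : R).
  by rewrite /Rintegral integral_indic// setIT.
rewrite -RintegralZr//; last exact: bounded_mfun_integrable.
apply: le_Rintegral => //.
- by apply: bounded_mfun_integrable; apply: bounded_mfunM => //; exact: bounded_mfun_cst.
- apply: bounded_mfun_integrable; rewrite (_ : (fun _ => _) = fun t => W t * W t); last first.
    by apply/funext => t; rewrite expr2.
  exact: bounded_mfunM.
move=> t _; have <- := congr1 (@^~ t) (indicator_gt_normE W u); have [uW|_] := ltP u `|W t|.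
  by rewrite mul1r -[W t ^+ 2]real_normK ?num_real// ler_sqr ?nnegrE ?(ltW uW) ?(ltW u0).
by rewrite mul0r sqr_ge0.
Qed.

(** After centring, the cross terms vanish and the second moment of the sum is n
times a single variance. *)
Lemma chebyshev_uncorrelated d (T : measurableType d) (R : realType)
    (P : probability T R) (h : nat -> T -> R) (m v u : R) (n : nat) :
  0 < u -> (forall k, bounded_mfun (h k)) ->
  (forall k, \int[P]_t h k t = m) ->
  (forall k, \int[P]_t (h k t * h k t) = v) ->
  (forall i j, i != j -> \int[P]_t (h i t * h j t) = m * m) ->
  fine (P [set t | u < `|\sum_(k < n) h k t - n%:R * m|]) <= n%:R * v / u ^+ 2.
Proof.
move=> u0 bh hm hv hij.
pose w k t := h k t - m.
have bw k : bounded_mfun (w k).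
  by apply: bounded_mfunD => //; exact: bounded_mfun_cst.
have wE t : \sum_(k < n) h k t - n%:R * m = \sum_(k < n) w k t.
  by rewrite sumrB sumr_const card_ord mulr_natl.
rewrite (_ : [set t | _] = [set t | u < `|\sum_(k < n) w k t|]); last first.
  by apply/seteqP; split => t /=; rewrite wE.
apply: le_trans (markov_square P u0 (bounded_mfun_sum n bw)) _.
rewrite ler_wpM2r// ?invr_ge0 ?exprn_ge0 ?(ltW u0)//.
have ww i j : \int[P]_t (w i t * w j t) = \int[P]_t (h i t * h j t) - m * m.
  rewrite (@eq_Rintegral _ _ _ _ _ (fun t => h i t * h j t +
    (m * m + (- m) * (h i t + h j t)))); last by move=> t _; rewrite /w; ring.
  have bij := bounded_mfunD (bh i) (bh j).
  have bm := bounded_mfun_cst T (- m).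
  have bmm := bounded_mfun_cst T (m * m).
  rewrite RintegralD//; last 2 first.
  - by apply: bounded_mfun_integrable; exact: bounded_mfunM.
  - by apply: bounded_mfun_integrable; apply: bounded_mfunD => //; exact: bounded_mfunM.
  rewrite RintegralD//; last 2 first.
  - exact: bounded_mfun_integrable.
  - by apply: bounded_mfun_integrable; exact: bounded_mfunM.
  rewrite (RintegralZl _ measurableT (bounded_mfun_integrable P bij)).
  rewrite RintegralD//; last 2 first.
  - exact: bounded_mfun_integrable.
  - exact: bounded_mfun_integrable.
  by rewrite Rintegral_probability_cst !hm; ring.
have -> : \int[P]_t ((\sum_(k < n) w k t) ^+ 2) =
    \sum_(i < n) \sum_(j < n) \int[P]_t (w i t * w j t).
  under eq_Rintegral do rewrite expr2 mulr_suml.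
  rewrite (@Rintegral_sum _ _ _ P (fun i t => w i t * \sum_(j < n) w j t)); last first.
    by move=> k; apply: bounded_mfunM => //; exact: bounded_mfun_sum.
  apply: eq_bigr => i _; under eq_Rintegral do rewrite mulr_sumr.
  by rewrite (@Rintegral_sum _ _ _ P (fun j t => w i t * w j t))// => k; exact: bounded_mfunM.
have -> : \sum_(i < n) \sum_(j < n) \int[P]_t (w i t * w j t) = \sum_(i < n) (v - m * m).
  apply: eq_bigr => i _; rewrite (bigD1 i)//= big1 ?addr0; first by rewrite ww hv.
  by move=> j ji; rewrite ww hij ?subrr// eq_sym.
by rewrite sumr_const card_ord -[leLHS]mulr_natl ler_wpM2l// gerBl -expr2 sqr_ge0.
Qed.

Lemma Rintegral_same_law d (T : measurableType d) (R : realType)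
    (P : probability T R) (X Y : T -> R) (phi : R -> R) :
  measurable_fun setT X -> measurable_fun setT Y -> measurable_fun setT phi ->
  (forall B, measurable B -> P (X @^-1` B) = P (Y @^-1` B)) ->
  P.-integrable setT (fun t => (phi (X t))%:E) ->
  P.-integrable setT (fun t => (phi (Y t))%:E) ->
  \int[P]_t phi (X t) = \int[P]_t phi (Y t).
Proof.
move=> mX mY mphi XY iX iY.
pose X' : {mfun T >-> R} := HB.pack X (isMeasurableFun.Build _ _ _ _ X mX).
pose Y' : {mfun T >-> R} := HB.pack Y (isMeasurableFun.Build _ _ _ _ Y mY).
have mphi' : measurable_fun setT (EFin \o phi) by exact/measurable_EFinP.
rewrite /Rintegral; congr fine.
have := integral_pushforward mX mphi' iX measurableT.
have := integral_pushforward mY mphi' iY measurableT.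
rewrite !preimage_setT /= => <- <-.
by apply: (@eq_measure_integral _ _ _ _ (pushforward P Y') (pushforward P X')) => A mA _; exact: XY.
Qed.

(** The joint law of [X] and [Y] agrees with the product of their laws on rectangles,
hence everywhere, and Fubini applies. *)
Lemma Rintegral_mul_indep d (T : measurableType d) (R : realType)
    (P : probability T R) (X Y : T -> R) (phi psi : R -> R) :
  measurable_fun setT X -> measurable_fun setT Y ->
  bounded_mfun phi -> bounded_mfun psi ->
  (forall A B, measurable A -> measurable B ->
     P (X @^-1` A `&` Y @^-1` B) = (P (X @^-1` A) * P (Y @^-1` B))%E) ->
  \int[P]_t (phi (X t) * psi (Y t)) =
  \int[P]_t phi (X t) * \int[P]_t psi (Y t).
Proof.
move=> mX mY bphi bpsi XY.
have [mphi [Cphi phiC]] := bphi; have [mpsi [Cpsi psiC]] := bpsi.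
pose X' : {mfun T >-> R} := HB.pack X (isMeasurableFun.Build _ _ _ _ X mX).
pose Y' : {mfun T >-> R} := HB.pack Y (isMeasurableFun.Build _ _ _ _ Y mY).
have mZ : measurable_fun setT (fun t => (X t, Y t)) by exact: measurable_fun_pair.
pose Z' : {mfun T >-> (R * R)%type} := HB.pack (fun t => (X t, Y t))
  (isMeasurableFun.Build _ _ _ _ (fun t => (X t, Y t)) mZ).
pose f (z : R * R) : R := phi z.1 * psi z.2.
have bf : bounded_mfun f.
  apply: bounded_mfunM; split.
  - exact: (measurableT_comp mphi measurable_fst).
  - by exists Cphi => z.
  - exact: (measurableT_comp mpsi measurable_snd).
  - by exists Cpsi => z.
have [mf _] := bf.
have mf' : measurable_fun setT (EFin \o f) by exact/measurable_EFinP.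
have bfZ : bounded_mfun (fun t => f (X t, Y t)).
  split; first exact: (measurableT_comp mf mZ).
  by case: bf => _ [C fC]; exists C => t.
have bX : bounded_mfun (fun t => phi (X t)).
  by split; [exact: (measurableT_comp mphi mX)|exists Cphi].
have bY : bounded_mfun (fun t => psi (Y t)).
  by split; [exact: (measurableT_comp mpsi mY)|exists Cpsi].
have lawX : \int[distribution P X']_v phi v = \int[P]_t phi (X t).
  rewrite /Rintegral; congr fine.
  have mphi' : measurable_fun setT (EFin \o phi) by exact/measurable_EFinP.
  exact: (integral_pushforward mX mphi' (bounded_mfun_integrable P bX) measurableT).
have lawY : \int[distribution P Y']_v psi v = \int[P]_t psi (Y t).
  rewrite /Rintegral; congr fine.
  have mpsi' : measurable_fun setT (EFin \o psi) by exact/measurable_EFinP.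
  exact: (integral_pushforward mY mpsi' (bounded_mfun_integrable P bY) measurableT).
have iprod : (distribution P X' \x distribution P Y')%E.-integrable setT (EFin \o f).
  apply: measurable_bounded_integrable => //.
    have PXY : (distribution P X' \x distribution P Y')%E setT = 1%E.
      rewrite -setXTT; apply: etrans (product_measure1E _ _ _ _) _ => //.
      apply: etrans (congr2 mule (probability_setT (distribution P X'))
        (probability_setT (distribution P Y'))) _.
      exact: mule1.
    apply: le_lt_trans (ltry 1).
    by rewrite le_eqVlt; apply/orP; left; apply/eqP; exact: PXY.
  case: bf => _ [C fC]; exists C; split; first exact: num_real.
  by move=> M CM t _ /=; rewrite (le_trans (fC t))// ltW.
transitivity (fine (\int[distribution P X' \x distribution P Y']_z (f z)%:E)%E).
  rewrite /Rintegral; congr fine.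
  have := integral_pushforward mZ mf' (bounded_mfun_integrable P bfZ) measurableT.
  rewrite /= => <-.
  apply: (@eq_measure_integral _ _ _ _ _ (pushforward P Z')) => A mA _.
  apply/esym/product_measure_unique => //.
rewrite -integral12_prod_meas1// -lawX -lawY -RintegralZr//; last first.
  exact: bounded_mfun_integrable.
rewrite /Rintegral; congr fine; apply: eq_integral => u _; rewrite /fubini_F /=.
have ipsi := bounded_mfun_integrable (distribution P Y') bpsi.
under eq_integral do rewrite EFinM.
apply: etrans (integralZl measurableT ipsi (phi u)) _.
by rewrite EFinM fineK//; exact: integrable_fin_num ipsi.
Qed.

(** * Truncation of iid sums *)

Definition trunc (R : realType) (u y : R) : R := y * (`|y| <= u)%R%:R.

Lemma bounded_trunc (R : realType) (u : R) : bounded_mfun (@trunc R u).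
Proof.
split.
  apply: measurable_funM => //.
  rewrite (_ : (fun _ => _) = \1_(`[- u, u]%classic : set R)).
    exact: measurable_indic.
  by apply/funext => y; rewrite indicE mem_setE in_itv/= ler_norml.
exists `|u| => y; rewrite /trunc; case: (leP `|y| u) => yu.
  by rewrite mulr1 (le_trans yu)// ler_norm.
by rewrite mulr0 normr0.
Qed.

Lemma trunc_sqr_le_powR (R : realType) (p u y : R) : p <= 2 -> 0 < u ->
  trunc u y ^+ 2 <= u `^ (2 - p) * `|y| `^ p.
Proof.
move=> p2 u0; rewrite /trunc; have [yu|_] := leP `|y| u; last first.
  by rewrite mulr0 expr0n/= mulr_ge0 ?powR_ge0.
rewrite mulr1; have [->|y0] := eqVneq y 0.
  by rewrite expr0n/= mulr_ge0 ?powR_ge0.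
have ny0 : 0 < `|y| by rewrite normr_gt0.
rewrite -[y ^+ 2]real_normK ?num_real//.
have -> : `|y| ^+ 2 = `|y| `^ (2 - p) * `|y| `^ p.
  by rewrite -powRD ?subrK ?powR_mulrn// (gt_eqF ny0) implybT.
by rewrite ler_wpM2r ?powR_ge0// ler_powR2r// subr_ge0.
Qed.

(** Raising the truncation level from [u] to 2u only adds values of modulus between
[u] and 2u. *)
Lemma trunc_sqr_double (R : realType) (u y : R) : 0 <= u ->
  trunc (2 * u) y ^+ 2 <= trunc u y ^+ 2 + (2 * u) ^+ 2 * (u < `|y|)%R%:R.
Proof.
move=> u0; rewrite /trunc; have [yu|uy] := leP `|y| u.
  by rewrite (le_trans yu) ?mulr1 ?mulr0 ?addr0//; lra.
rewrite mulr0 expr0n/= add0r mulr1; have [yu2|_] := leP `|y| (2 * u).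
  rewrite mulr1 -[y ^+ 2]real_normK ?num_real//.
  by rewrite ler_sqr ?nnegrE// mulr_ge0.
by rewrite mulr0 expr0n/= sqr_ge0.
Qed.

(** If |S| > 2u, then either some term exceeds [u] in modulus, or S equals the sum
of the truncated terms, whose total mean is at most [u] in modulus, so that this
sum deviates from its mean by more than [u]. *)
Lemma tail_sum_iid d (T : measurableType d) (R : realType)
    (P : probability T R) (x : nat -> T -> R) (u : R) (n : nat) :
  0 < u -> (forall k, measurable_fun setT (x k)) ->
  (forall k B, measurable B -> P (x k @^-1` B) = P (x 0%N @^-1` B)) ->
  (forall i j A B, i != j -> measurable A -> measurable B ->
     P (x i @^-1` A `&` x j @^-1` B) = (P (x i @^-1` A) * P (x j @^-1` B))%E) ->
  n%:R * `|\int[P]_t trunc u (x 0%N t)| <= u ->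
  fine (P [set t | 2 * u < `|\sum_(k < n) x k t|]) <=
    n%:R * fine (P [set t | u < `|x 0%N t|]) +
    n%:R * (\int[P]_t (trunc u (x 0%N t) ^+ 2)) / u ^+ 2.
Proof.
move=> u0 mx same indep nm; set m := \int[P]_t trunc u (x 0%N t) in nm *.
have bh k : bounded_mfun (fun t => trunc u (x k t)).
  by apply: bounded_mfun_comp => //; exact: bounded_trunc.
have btt : bounded_mfun (fun y => trunc u y * trunc u y).
  by apply: bounded_mfunM; exact: bounded_trunc.
have law phi k : bounded_mfun phi -> \int[P]_t phi (x k t) = \int[P]_t phi (x 0%N t).
  move=> bphi; apply: Rintegral_same_law => //; first by case: bphi.
  - by move=> B; exact: same.
  - by apply: bounded_mfun_integrable; exact: bounded_mfun_comp.
  - by apply: bounded_mfun_integrable; exact: bounded_mfun_comp.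
have cheb := @chebyshev_uncorrelated _ T R P (fun k t => trunc u (x k t)) m
  (\int[P]_t (trunc u (x 0%N t) * trunc u (x 0%N t))) u n u0 bh.
have {}cheb := cheb (fun k => law _ k (bounded_trunc u)) (fun k => law _ k btt).
have {}cheb : fine (P [set t | u < `|\sum_(k < n) trunc u (x k t) - n%:R * m|]) <=
    n%:R * (\int[P]_t (trunc u (x 0%N t) ^+ 2)) / u ^+ 2.
  under [in leRHS]eq_Rintegral do rewrite expr2.
  apply: cheb => i j ij.
  rewrite (@Rintegral_mul_indep _ T R P (x i) (x j) (trunc u) (trunc u))//.
  - by rewrite (law _ i (bounded_trunc u)) (law _ j (bounded_trunc u)).
  - exact: bounded_trunc.
  - exact: bounded_trunc.
  - by move=> A B; exact: indep.
apply: le_trans (lerD (lexx _) cheb).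
have -> : fine (P [set t | u < `|x 0%N t|]) = \int[P]_t (\1_[set t | u < `|x 0%N t|] t : R).
  by apply: fine_probabilityE; exact: measurable_gt_norm.
have nE : n%:R * \int[P]_t (\1_[set t | u < `|x 0%N t|] t : R) =
    \int[P]_t (\sum_(k < n) (u < `|x k t|)%R%:R).
  have bu : bounded_mfun (\1_[set y | u < `|y|] : R -> R).
    by apply: bounded_indic; exact: measurable_gt_norm.
  rewrite (@Rintegral_sum _ _ _ P (fun k t => (u < `|x k t|)%R%:R)); last first.
    by move=> k; rewrite indicator_gt_normE; apply: bounded_indic; exact: measurable_gt_norm.
  under eq_bigr => k _.
    have -> : \int[P]_t ((u < `|x k t|)%R%:R : R) = \int[P]_t \1_[set y | u < `|y|] (x k t).
      by apply: eq_Rintegral => t _; rewrite -(indicator_gt_normE id).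
    rewrite law//; over.
  by rewrite sumr_const card_ord mulr_natl.
have mS : measurable_fun setT (fun t => \sum_(k < n) x k t) by exact: measurable_sum.
have bhs : bounded_mfun (fun t => \sum_(k < n) trunc u (x k t)).
  exact: (bounded_mfun_sum (f := fun k t => trunc u (x k t))).
have bW : bounded_mfun (fun t => \sum_(k < n) trunc u (x k t) - n%:R * m).
  by apply: bounded_mfunD => //; exact: bounded_mfun_cst.
have [mW _] := bW.
have mA := measurable_gt_norm u mW.
have mB := measurable_gt_norm (2 * u) mS.
have bs : bounded_mfun (fun t => \sum_(k < n) (u < `|x k t|)%R%:R : R).
  apply: (bounded_mfun_sum (f := fun k t => (u < `|x k t|)%R%:R)) => k.
  by rewrite indicator_gt_normE; apply: bounded_indic; exact: measurable_gt_norm.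
rewrite nE !fine_probabilityE// -RintegralD//; last 2 first.
- exact: bounded_mfun_integrable.
- by apply: bounded_mfun_integrable; exact: bounded_indic.
apply: le_Rintegral => //.
- by apply: bounded_mfun_integrable; exact: bounded_indic.
- by apply: bounded_mfun_integrable; apply: bounded_mfunD => //; exact: bounded_indic.
move=> t _; rewrite -!(indicator_gt_normE).
have S1 : 0 <= \sum_(k < n) (u < `|x k t|)%R%:R :> R by exact: sumr_ge0.
have [uS|_] := ltP (2 * u) _; last by rewrite addr_ge0.
have [/existsP[i ui]|/existsPn small] := boolP [exists i : 'I_n, u < `|x i t|].
  by rewrite (bigD1 i)//= ui -addrA lerDl addr_ge0// sumr_ge0.
rewrite (_ : u < _) ?lerDr//.
have -> : \sum_(k < n) trunc u (x k t) = \sum_(k < n) x k t.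
  by apply: eq_bigr => i _; rewrite /trunc leNgt small mulr1.
have := lerB_dist (\sum_(k < n) x k t) (n%:R * m).
have : `|n%:R * m| <= u by rewrite normrM normr_nat.
lra.
Qed.

(** With u_k = M 2^k and M^p = n A, let g_k be the Chebyshev bound for the sum
truncated at u_k. The sequence u_k^q g_k^r obeys a recursive inequality with
ratio theta = 2^q 4^(-r), and theta < 1 because p < 2. *)
Lemma lorentz_int_sum_iid (R : realType) (p q L : R) (x : nat -> R -> R) :
  1 <= q -> q <= p -> 1 < p -> p < 2 ->
  (forall k, measurable_fun setT (x k)) ->
  (forall k B, measurable B -> mu01 (x k @^-1` B) = mu01 (x 0%N @^-1` B)) ->
  (forall i j A B, i != j -> measurable A -> measurable B ->
     mu01 (x i @^-1` A `&` x j @^-1` B) =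
     (mu01 (x i @^-1` A) * mu01 (x j @^-1` B))%E) ->
  \int[@mu01 R]_t x 0%N t = 0 ->
  (lorentz_int q (q / p) (x 0%N) <= L%:E)%E ->
  exists C : R, forall n, (0 < n)%N ->
    (lorentz_int q (q / p) (fun t => \sum_(k < n) x k t)%R <=
       (C * n%:R `^ (q / p))%:E)%E.
Proof.
move=> q1 qp p1 p2 mx same indep mean0 IL.
have q0 : 0 < q by exact: lt_le_trans q1.
have p0 : 0 < p by exact: lt_trans p1.
pose r := q / p.
have r0 : 0 < r by rewrite divr_gt0.
have r1 : r <= 1 by rewrite ler_pdivrMr// mul1r.
have [A A0 [ixp IA]] := integrable_powR_of_lorentz q1 qp (mx 0%N) IL.
pose f := x 0%N; have mf : measurable_fun setT f by exact: mx.
have iff : (@mu01 R).-integrable setT (EFin \o f).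
  exact: integrable_of_powR (ltW p1) mf ixp.
have bt u : bounded_mfun (fun t => trunc u (f t)).
  by apply: bounded_mfun_comp => //; exact: bounded_trunc.
have itp c : (@mu01 R).-integrable setT (EFin \o (fun t => c * `|f t| `^ p)).
  exact: (integrableZl measurableT c ixp).
have bt2 u : bounded_mfun (fun t => trunc u (f t) ^+ 2).
  rewrite (_ : (fun _ => _) = fun t => trunc u (f t) * trunc u (f t)); last first.
    by apply/funext => t; rewrite expr2.
  exact: bounded_mfunM.
(* the mean of x is 0, so the truncated mean is minus the mean of the rest *)
have mean u : 0 < u -> `|\int[@mu01 R]_t trunc u (f t)| <= u `^ (1 - p) * A.
  move=> u0.
  have -> : \int[@mu01 R]_t trunc u (f t) = - \int[@mu01 R]_t (f t - trunc u (f t)).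
    rewrite (RintegralB measurableT iff (bounded_mfun_integrable _ (bt u))).
    by rewrite mean0 sub0r opprK.
  rewrite normrN.
  have ib : (@mu01 R).-integrable setT (EFin \o (fun t => f t - trunc u (f t))).
    exact: (integrableB measurableT iff (bounded_mfun_integrable _ (bt u))).
  apply: le_trans (le_normr_Rintegral _ ib) _ => //.
  apply: le_trans (ler_wpM2l (powR_ge0 _ _) IA).
  rewrite -RintegralZl//; apply: le_Rintegral => //.
  - exact: (integrable_abse ib).
  move=> t _; rewrite /trunc; have [fu|fu] := leP `|f t| u.
    by rewrite mulr1 subrr normr0 mulr_ge0 ?powR_ge0.
  by rewrite mulr0 subr0 norm_le_powR// ltW.
have sq u : 0 < u -> \int[@mu01 R]_t (trunc u (f t) ^+ 2) <= u `^ (2 - p) * A.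
  move=> u0; apply: le_trans (ler_wpM2l (powR_ge0 _ _) IA).
  rewrite -RintegralZl//; apply: le_Rintegral => //.
  - exact: bounded_mfun_integrable.
  - by move=> t _; apply: trunc_sqr_le_powR => //; exact: ltW.
have sqd u : 0 < u -> \int[@mu01 R]_t (trunc (2 * u) (f t) ^+ 2) <=
    \int[@mu01 R]_t (trunc u (f t) ^+ 2) + (2 * u) ^+ 2 * tail f u.
  move=> u0.
  have bi : bounded_mfun (\1_[set t | u < `|f t|] : R -> R).
    by apply: bounded_indic; exact: measurable_gt_norm.
  have -> : tail f u = \int[@mu01 R]_t (\1_[set t | u < `|f t|] t : R).
    by apply: fine_probabilityE; exact: measurable_gt_norm.
  have bi2 : bounded_mfun (fun t => (2 * u) ^+ 2 * \1_[set t | u < `|f t|] t).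
    by apply: bounded_mfunM => //; exact: bounded_mfun_cst.
  rewrite -RintegralZl//; last exact: bounded_mfun_integrable.
  rewrite -RintegralD//; last 2 first.
  - exact: bounded_mfun_integrable.
  - exact: (bounded_mfun_integrable _ bi2).
  apply: le_Rintegral => //.
  - exact: bounded_mfun_integrable.
  - by apply: bounded_mfun_integrable; exact: bounded_mfunD.
  move=> t _; rewrite -indicator_gt_normE; apply: trunc_sqr_double; exact: ltW.
pose theta : R := 2 `^ q * (4^-1) `^ r.
have th0 : 0 <= theta by rewrite mulr_ge0 ?powR_ge0.
have th1 : theta < 1.
  have -> : theta = 2 `^ (- (2 * r - q)).
    rewrite /theta (_ : 4^-1 = 2 `^ (- 2)); last first.
      by rewrite powRN powR_mulrn// -natrX.
    by rewrite -powRrM -powRD ?pnatr_eq0 ?implybT//; congr (_ `^ _); ring.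
  apply: powR2_opp_lt1; rewrite subr_gt0 /r mulrA ltr_pdivlMr//.
  by rewrite mulrC ltr_pM2r.
exists (integral_powR_const r * (2 `^ q * A `^ r + 4 `^ q * (2 * L +
  (A `^ r + 2 `^ q * (2 * L)) / (1 - theta)))) => n n0.
have nR0 : 0 < n%:R :> R by rewrite ltr0n.
(* below this level the trivial bound 1 on the tail of the sum suffices *)
pose M := (n%:R * A) `^ p^-1.
have nA0 : 0 < n%:R * A by rewrite mulr_gt0.
have M0 : 0 < M by rewrite powR_gt0.
have Mp : M `^ p = n%:R * A by rewrite -powRrM mulVf ?gt_eqF// powRr1// ltW.
have Mq : M `^ q = n%:R `^ r * A `^ r.
  by rewrite -powRM ?(ltW A0)// -powRrM (mulrC p^-1).
pose u k := M * 2 ^+ k.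
have u0 k : 0 < u k by exact: dyadic_level_gt0.
have uS k : u k.+1 = 2 * u k by rewrite /u exprS mulrCA.
have Mu k : M <= u k by rewrite ler_peMr ?(ltW M0)// exprn_ege1// ler1n.
pose S t := \sum_(k < n) x k t.
have mS : measurable_fun setT S by exact: measurable_sum.
pose g k := n%:R * (\int[@mu01 R]_t (trunc (u k) (f t) ^+ 2)) / u k ^+ 2.
have g_ge0 k : 0 <= g k.
  by rewrite divr_ge0 ?sqr_ge0// mulr_ge0// Rintegral_ge0// => t _; exact: sqr_ge0.
have tailS k : tail S (2 * u k) <= n%:R * tail f (u k) + g k.
  apply: (@tail_sum_iid _ _ R (@mu01 R) x (u k) n (u0 k) mx same indep).
  apply: le_trans (ler_wpM2l (ltW nR0) (mean _ (u0 k))) _.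
  have {2}-> : u k = u k `^ (1 - p) * u k `^ p.
    by rewrite -powRD ?subrK ?powRr1 ?oner_eq0// ltW.
  by rewrite mulrCA -Mp ler_wpM2l ?powR_ge0// ler_powR2r ?(ltW p0) ?(ltW M0).
have g0 : g 0%N <= 1.
  rewrite /g ler_pdivrMr ?exprn_gt0// mul1r.
  apply: le_trans (ler_wpM2l (ltW nR0) (sq _ (u0 0%N))) _.
  rewrite {1 2}/u expr0 mulr1 mulrCA -Mp -powRD ?subrK ?pnatr_eq0//.
  by rewrite powR_mulrn// ltW.
have gS k : g k.+1 <= g k / 4 + n%:R * tail f (u k).
  rewrite /g uS ler_pdivrMr ?exprn_gt0 ?mulr_gt0//.
  apply: le_trans (ler_wpM2l (ltW nR0) (sqd _ (u0 k))) _.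
  rewrite [leLHS]mulrDr [leRHS]mulrDl lerD//; last by rewrite mulrCA mulrC.
  rewrite le_eqVlt; apply/orP; left; apply/eqP; field.
  by rewrite gt_eqF.
pose e k := u k `^ q * tail f (u k) `^ r.
have eL m : \sum_(k < m) e k <= 2 * L.
  rewrite -lee_fin; apply: le_trans (lorentz_int_ge_dyadic m q1 r0 r1 M0 mf) _.
  by rewrite EFinM lee_wpmul2l// lee_fin.
pose H k := u k `^ q * g k `^ r.
have H_ge0 k : 0 <= H k by rewrite mulr_ge0 ?powR_ge0.
have HS k : H k.+1 <= theta * H k + 2 `^ q * n%:R `^ r * e k.
  have -> : theta * H k + 2 `^ q * n%:R `^ r * e k =
      u k.+1 `^ q * ((g k / 4) `^ r + (n%:R * tail f (u k)) `^ r).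
    rewrite uS (@powRM _ 2 (u k)) ?(ltW (u0 k))// (@powRM _ (g k) 4^-1) ?invr_ge0//.
    rewrite (@powRM _ n%:R) ?tail_ge0//.
    rewrite /theta /H /e; ring.
  rewrite ler_wpM2l ?powR_ge0//.
  apply: le_trans (powR_subadd r0 r1 _ _); last 2 first.
  - by rewrite divr_ge0.
  - by rewrite mulr_ge0 ?tail_ge0 ?ltW.
  by rewrite ler_powR2r ?(ltW r0).
have sumH m : \sum_(k < m) H k <=
    (M `^ q + 2 `^ q * n%:R `^ r * (2 * L)) / (1 - theta).
  have thp : 0 < 1 - theta by rewrite subr_gt0.
  apply: le_trans (@sum_contraction _ H (fun k => 2 `^ q * n%:R `^ r * e k)
    theta (2 `^ q * n%:R `^ r * (2 * L)) m th0 th1 H_ge0 HS _) _.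
    by move=> j; rewrite -mulr_sumr ler_wpM2l ?mulr_ge0 ?powR_ge0.
  rewrite ler_pM2r ?invr_gt0// lerD2r /H {1}/u expr0 mulr1 -[leRHS]mulr1.
  rewrite ler_wpM2l ?powR_ge0//.
  by have := ler_powR2r (ltW r0) (g_ge0 0%N) g0; rewrite powR1.
have -> : integral_powR_const r * (2 `^ q * A `^ r + 4 `^ q * (2 * L +
    (A `^ r + 2 `^ q * (2 * L)) / (1 - theta))) * n%:R `^ (q / p) =
  integral_powR_const r * ((2 * M) `^ q + 4 `^ q * (n%:R `^ r * (2 * L) +
    (M `^ q + 2 `^ q * n%:R `^ r * (2 * L)) / (1 - theta))).
  rewrite powRM ?(ltW M0)// Mq -/r; ring.
apply: (@lorentz_int_le_dyadic _ q r S (2 * M)) => //; first by rewrite mulr_gt0.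
move=> m; rewrite lerD2l.
apply: (@le_trans _ _ (4 `^ q * \sum_(k < m) (n%:R `^ r * e k + H k))).
  rewrite mulr_sumr; apply: ler_sum => k _.
  have -> : 2 * M * 2 ^+ k = 2 * u k by rewrite /u mulrA.
  have -> : 2 * M * 2 ^+ k.+1 = 4 * u k by rewrite /u exprS; ring.
  rewrite (@powRM _ 4 (u k)) ?(ltW (u0 k))// -mulrA ler_wpM2l ?powR_ge0//.
  have -> : n%:R `^ r * e k + H k =
      u k `^ q * ((n%:R * tail f (u k)) `^ r + g k `^ r).
    by rewrite (@powRM _ n%:R) ?tail_ge0// /e /H; ring.
  rewrite ler_wpM2l ?powR_ge0//.
  apply: le_trans (powR_subadd r0 r1 _ (g_ge0 k)).
    by rewrite ler_powR2r ?(ltW r0) ?tail_ge0.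
  by rewrite mulr_ge0 ?tail_ge0 ?ltW.
rewrite ler_wpM2l ?powR_ge0// big_split/=; apply: lerD; last exact: sumH.
by rewrite -mulr_sumr; exact: (ler_wpM2l (powR_ge0 _ _) (eL m)).
Qed.

(** * Weakly null iid sequences *)

(** Functions of the space are measurable on [0, 1] only; cutting them off outside
makes them random variables on the whole line without changing their norm. *)
Definition cut01 (R : realType) (x : R -> R) : R -> R := x \_ `[0, 1].

Lemma cut01E (R : realType) (x : R -> R) (t : R) :
  cut01 x t = if t \in `[0, 1] then x t else 0.
Proof. by rewrite /cut01 patchE mem_setE. Qed.

Lemma cut01_in (R : realType) (x : R -> R) : {in `[0, 1], cut01 x =1 x}.
Proof. by move=> t t01; rewrite cut01E t01. Qed.

Lemma measurable_cut01 (R : realType) (x : R -> R) :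
  measurable_fun (`[0%R, 1%R] : set R) x -> measurable_fun setT (cut01 x).
Proof. by move=> mx; apply: (measurable_restrictT x _).1. Qed.

Lemma mu01_preimage_cut01 (R : realType) (x : R -> R) (B : set R) :
  mu01 (cut01 x @^-1` B) = leb01 (x @^-1` B).
Proof. by apply: leb01_congr => t t01; rewrite /= cut01_in. Qed.

Definition mean01 (R : realType) (x : R -> R) : R := \int[@mu01 R]_t cut01 x t.

Lemma fspace_lorentz (R : realType) (p q : R) (x : R -> R) :
  1 <= q -> q <= p -> 1 < p -> fspace (lorentz_norm p q) x ->
  [/\ measurable_fun setT (cut01 x),
     lorentz_int q (q / p) (cut01 x) \is a fin_num &
     (@mu01 R).-integrable setT (EFin \o cut01 x)].
Proof.
move=> q1 qp p1 [mx Nx].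
have q0 : 0 < q by exact: lt_le_trans q1.
have p0 : 0 < p by exact: lt_trans p1.
have mc := measurable_cut01 mx.
have Ifin : lorentz_int q (q / p) (cut01 x) \is a fin_num.
  by apply: (lorentz_int_fin_num p0 q0); rewrite (lorentz_norm_congr p q (@cut01_in _ x)).
split => //.
have [A _ [ixp _]] := @integrable_powR_of_lorentz _ p q
  (fine (lorentz_int q (q / p) (cut01 x))) _ q1 qp mc (le_fineK Ifin).
exact: integrable_of_powR (ltW p1) mc ixp.
Qed.

(** Homogeneity comes from applying [le_Rintegral_lorentz] at every scale M larger
than I(x)^(1/q), and letting M decrease to it. *)
Lemma mean01_fdual (R : realType) (p q : R) : 1 <= q -> q <= p -> 1 < p ->
  fdual (lorentz_norm p q) (@mean01 R).
Proof.
move=> q1 qp p1.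
have q0 : 0 < q by exact: lt_le_trans q1.
have p0 : 0 < p by exact: lt_trans p1.
split.
  move=> a x y /(fspace_lorentz q1 qp p1)[_ _ ix] /(fspace_lorentz q1 qp p1)[_ _ iy].
  rewrite /mean01 -RintegralZl// -RintegralD//; last first.
    exact: (integrableZl measurableT a ix).
  apply: eq_Rintegral => t _; rewrite !cut01E; case: ifP => // _.
  by rewrite mulr0 addr0.
set K := 1 + (1 + (2 : R) `^ p * 2 `^ (p / q)).
exists (K * (p / q)) => x fx; have [mc Ifin ic] := fspace_lorentz q1 qp p1 fx.
rewrite -(lorentz_norm_congr p q (@cut01_in _ x)) lorentz_normE//.
have K0 : 0 < K by rewrite addr_gt0// ltr_wpDr// mulr_ge0 ?powR_ge0.
set I := lorentz_int _ _ _ in Ifin *.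
have I0 : 0 <= fine I by rewrite fine_ge0// lorentz_int_ge0.
rewrite -(fineK Ifin) poweR_EFin -!EFinM lee_fin.
have -> : K * (p / q) * (q / p * fine I `^ q^-1) = K * fine I `^ q^-1.
  by rewrite mulrACA -mulrA; field; rewrite !gt_eqF.
apply/ler_addgt0Pr => e e0.
have eK : 0 < e / K by rewrite divr_gt0.
have M0 : 0 < fine I `^ q^-1 + e / K by rewrite ltr_wpDl// powR_ge0.
have IM : (I <= ((fine I `^ q^-1 + e / K) `^ q)%:E)%E.
  rewrite -(fineK Ifin) lee_fin.
  have {1}-> : fine I = (fine I `^ q^-1) `^ q.
    by rewrite -powRrM mulVf ?gt_eqF// powRr1.
  by rewrite ler_powR2r ?(ltW q0) ?powR_ge0// lerDl ltW.
have [_] := le_Rintegral_lorentz q1 qp p1 M0 mc IM.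
by rewrite mulrDr mulrCA divff ?gt_eqF// mulr1.
Qed.

(** The whole sequence is already a p-BS-sequence: a subsequence of an iid sequence
is iid with the same law, so the bound of [lorentz_int_sum_iid] applies to it. *)
Lemma Gamma_iid_lorentz (R : realType) (p q : R) :
  1 <= q -> q <= p -> 1 < p -> p < 2 -> Gamma_iid (lorentz_norm p q) p.
Proof.
move=> q1 qp p1 p2.
have q0 : 0 < q by exact: lt_le_trans q1.
have p0 : 0 < p by exact: lt_trans p1.
split; first exact: ltW.
move=> x [fx wx] indep same.
pose y n := cut01 (x n).
have my n : measurable_fun setT (y n) by have [] := fspace_lorentz q1 qp p1 (fx n).
have iy n : (@mu01 R).-integrable setT (EFin \o y n).
  by have [] := fspace_lorentz q1 qp p1 (fx n).
have law m n B : measurable B -> mu01 (y m @^-1` B) = mu01 (y n @^-1` B).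
  by move=> mB; rewrite !mu01_preimage_cut01; exact: same.
(* phi (x n) does not depend on n and tends to 0 *)
have mean_const n : mean01 (x n) = mean01 (x 0%N).
  exact: (@Rintegral_same_law _ _ _ _ (y n) (y 0%N) id (my n) (my 0%N)
    (@measurable_id _ _ _) (law n 0%N) (iy n) (iy 0%N)).
have mean0 : mean01 (x 0%N) = 0.
  have /cvg_lim := wx _ (mean01_fdual q1 qp p1).
  rewrite (_ : (fun n => _) = fun=> mean01 (x 0%N)); last exact/funext.
  by rewrite lim_cst => // ->.
have pair i j A B : i != j -> measurable A -> measurable B ->
    mu01 (y i @^-1` A `&` y j @^-1` B) = (mu01 (y i @^-1` A) * mu01 (y j @^-1` B))%E.
  move=> ij mA mB.
  pose D k := if k == i then A else B.
  have mD k : measurable (D k) by rewrite /D; case: ifP.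
  have := indep [:: i; j] D; rewrite /= inE ij => /(_ isT mD).
  rewrite !big_cons big_nil mule1 /D eqxx eq_sym (negbTE ij) => H.
  rewrite !mu01_preimage_cut01 -H; apply: leb01_congr => t t01.
  have yx k : y k t = x k t by rewrite /y cut01_in.
  rewrite /preimage /= !yx; split.
    move=> [At Bt] k; rewrite /= !inE => /orP[/eqP ->|/eqP ->].
      by rewrite eqxx.
    by rewrite eq_sym (negbTE ij).
  move=> H'; split.
    by have := H' i; rewrite /= eqxx inE eqxx => /(_ isT).
  by have := H' j; rewrite /= eq_sym (negbTE ij) !inE eqxx orbT => /(_ isT).
exists id => //; split => //.
  apply: (@le_lt_trans _ _ (lorentz_norm p q (x 0%N))); last by have [] := fx 0%N.
  apply: ge_ereal_sup => _ [n _ <-] /=.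
  rewrite -(lorentz_norm_congr p q (@cut01_in _ (x n))).
  rewrite -(lorentz_norm_congr p q (@cut01_in _ (x 0%N))).
  by rewrite /lorentz_norm (rearrangement_same_law (law n 0%N)).
move=> k kinc; have kinj := increasing_seq_injective kinc.
have [_ Ifin _] := fspace_lorentz q1 qp p1 (fx (k 0%N)).
have [C HC] := @lorentz_int_sum_iid _ p q (fine (lorentz_int q (q / p) (y (k 0%N))))
  (y \o k) q1 qp p1 p2 (fun i => my (k i)) (fun i B => law (k i) (k 0%N) B)
  (fun i j A B ij => pair (k i) (k j) A B (contra_neq (@kinj i j) ij))
  (etrans (mean_const (k 0%N)) mean0) (le_fineK Ifin).
have C0 : 0 <= C.
  have := HC 1%N isT; rewrite powR1 mulr1; move/(le_trans (lorentz_int_ge0 _ _ _)).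
  by rewrite lee_fin.
apply: (@le_lt_trans _ _ (q / p * C `^ q^-1)%:E); last exact: ltry.
apply: ge_ereal_sup => _ [j j0 <-].
have jR : 0 < j%:R :> R by rewrite ltr0n.
rewrite (lorentz_norm_congr (y := fun t => \sum_(i < j) y (k i) t) p q); last first.
  by move=> t t01; apply: eq_bigr => i _; rewrite /y cut01_in.
apply: (@le_trans _ _ ((j%:R `^ (- p^-1))%:E * (q / p * (C * j%:R `^ (q / p)) `^ q^-1)%:E)%E).
  apply: lee_wpmul2l; first by rewrite lee_fin powR_ge0.
  by apply: lorentz_norm_le => //; [rewrite mulr_ge0 ?powR_ge0|exact: HC].
rewrite -EFinM lee_fin powRM ?powR_ge0// -powRrM.
have -> : q / p / q = p^-1 by field; rewrite !gt_eqF.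
rewrite powRN; have jp : 0 < j%:R `^ p^-1 by rewrite powR_gt0.
by rewrite mulrCA [X in _ * X]mulrCA mulVf ?gt_eqF// mulr1.
Qed.

(** * Sums of lacunary bumps *)

Definition bump (R : realType) (A : nat -> set R) (c : nat -> R) (k : nat) :
  R -> R := fun t => c k * \1_(A k) t.

Lemma measurable_bump (R : realType) (A : nat -> set R) (c : nat -> R) (k : nat) :
  measurable (A k) -> measurable_fun setT (bump A c k).
Proof. by move=> mA; apply: measurable_funM => //; exact: measurable_indic. Qed.

(** Fix t and keep only the indices with t < 2 a_k, where a_k is the measure of the
k-th set. The discarded sets have total measure at most t by lacunarity, so x*(t)
is at most the sum of the remaining heights, and [lacunary_powR_sum] turns its
q-th power into the required combination of indicators. *)
Lemma lorentz_int_bump_le (R : realType) (p q : R) (A : nat -> set R)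
    (c s : nat -> R) (n : nat) :
  1 <= q -> q <= p -> (forall k, measurable (A k)) ->
  (forall k, 0 < c k) -> (forall k, 2 * c k <= c k.+1) ->
  (forall k, mu01 (A k) = (c k `^ (- p))%:E) -> (forall k, `|s k| <= 1) ->
  (lorentz_int q (q / p) (fun t => \sum_(k < n) s k * bump A c k t)%R <=
     (integral_powR_const (q / p) * (2 `^ q * 2 `^ (q / p) * n%:R))%:E)%E.
Proof.
move=> q1 qp mA c0 c2 Ac s1.
have q0 : 0 < q by exact: lt_le_trans q1.
have p0 : 0 < p by exact: lt_le_trans qp.
have p1 : 1 <= p by exact: le_trans qp.
have r0 : 0 < q / p by rewrite divr_gt0.
have r1 : q / p <= 1 by rewrite ler_pdivrMr// mul1r.
have c_ge0 k : 0 <= c k by exact: ltW.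
pose a k := c k `^ (- p).
have a0 k : 0 <= a k by exact: powR_ge0.
have a2 := lacunary_powR_opp p1 c0 c2 : forall k, 2 * a k.+1 <= a k.
pose y t := \sum_(k < n) s k * bump A c k t.
have my : measurable_fun setT y.
  apply: measurable_sum => k; apply: measurable_funM => //; exact: measurable_bump.
have bA k : bounded_mfun (\1_(A k) : R -> R) by exact: bounded_indic.
(* sg is the sum of the heights kept; |y| > sg only on the discarded sets *)
have bumps t sigma : 0 <= t -> sigma = \sum_(k < n) c k * (t < 2 * a k)%R%:R ->
    tail y sigma <= t.
  move=> t0 ->; set sg := \sum_(k < n) _.
  apply: (@le_trans _ _ (\int[@mu01 R]_u
      (\sum_(k < n) (2 * a k <= t)%R%:R * \1_(A k) u))).
    rewrite [leLHS]fine_probabilityE; last exact: measurable_gt_norm.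
    have bs k : bounded_mfun (fun u => (2 * a k <= t)%R%:R * \1_(A k) u : R).
      by apply: bounded_mfunM => //; exact: bounded_mfun_cst.
    apply: le_Rintegral => //.
    - by apply: bounded_mfun_integrable; apply: bounded_indic; exact: measurable_gt_norm.
    - apply: bounded_mfun_integrable.
      exact: (bounded_mfun_sum (f := fun k u => (2 * a k <= t)%R%:R * \1_(A k) u)).
    move=> u _; rewrite -indicator_gt_normE.
    have [[k ku]|none] := pselect (exists k : 'I_n, (2 * a k <= t) && (u \in A k)).
      move/andP: ku => [kt uA]; rewrite (bigD1 k)//= kt mul1r indicE uA.
      apply: (@le_trans _ _ 1); first by rewrite lern1 leq_b1.
      by rewrite lerDl sumr_ge0// => i _; rewrite mulr_ge0// indicE.
    have : `|y u| <= sg.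
      rewrite (le_trans (ler_norm_sum _ _ _))//; apply: ler_sum => k _.
      rewrite normrM /bump normrM (ger0_norm (c_ge0 k)) indicE normr_nat.
      apply: (@le_trans _ _ (c k * (u \in A k)%:R)).
        by rewrite ler_piMl// mulr_ge0.
      rewrite ler_wpM2l// ler_nat; case: (boolP (u \in A k)) => // uA.
      rewrite ltNge; case: (boolP (2 * a k <= t)) => // kt.
      by case: none; exists k; rewrite kt uA.
    rewrite leNgt => /negbTE ->; apply: sumr_ge0 => k _.
    by rewrite mulr_ge0// indicE.
  rewrite (@Rintegral_sum _ _ _ _ (fun k u => (2 * a k <= t)%R%:R * \1_(A k) u)); last first.
    by move=> k; apply: bounded_mfunM => //; exact: bounded_mfun_cst.
  rewrite (eq_bigr (fun k : 'I_n => a k * (2 * a k <= t)%R%:R)); last first.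
    move=> k _; rewrite RintegralZl//; last exact: bounded_mfun_integrable.
    by rewrite -fine_probabilityE// [X in fine X](Ac k) mulrC.
  rewrite (le_trans (lacunary_decr_sum_max (z := t / 2) (b := fun k => 2 * a k <= t) n a0 a2 _ _))//.
  - by rewrite divr_ge0.
  - by move=> k; rewrite ler_pdivlMr// mulrC.
  - by rewrite mulrC divfK.
(* capped at 1, which changes nothing for t < 1 *)
pose d k := Num.min 1 (2 * a k).
pose v k := (2 * c k) `^ q * (k < n)%N%:R.
have v0 k : 0 <= v k by rewrite mulr_ge0 ?powR_ge0.
have d0 k : 0 <= d k by rewrite le_min ler01 mulr_ge0.
apply: (@lorentz_int_le _ _ _ _ v d) => // [k|t t0 t1|m].
- by rewrite ge_min lexx.
- set sg := \sum_(k < n) c k * (t < 2 * a k)%R%:R.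
  have sg0 : 0 <= sg by rewrite sumr_ge0// => k _; rewrite mulr_ge0.
  apply: (@le_trans _ _ (sg `^ q)%:E).
    apply: poweR_le; rewrite ?(ltW q0) ?rearrangement_ge0//.
    exact: (rearrangement_le my sg0 (bumps t sg (ltW t0) erefl)).
  apply: (@le_trans _ _ (\sum_(k < n) (2 * c k) `^ q * (t < 2 * a k)%R%:R)%:E).
    by rewrite lee_fin; exact: (lacunary_powR_sum (fun k => t < 2 * a k) n q0 c_ge0 c2).
  apply: le_trans (nneseries_lim_ge n _); last first.
    by move=> k _ _; rewrite lee_fin mulr_ge0.
  rewrite sumEFin big_mkord lee_fin; apply: ler_sum => k _.
  by rewrite /v ltn_ord mulr1 /d lt_min t1.
apply: (@le_trans _ _ (\sum_(k < m) (2 `^ q * 2 `^ (q / p)) * (k < n)%N%:R)).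
  apply: ler_sum => k _; rewrite /v mulrAC ler_wpM2r//.
  apply: (@le_trans _ _ ((2 * c k) `^ q * (2 * a k) `^ (q / p))).
    rewrite ler_wpM2l ?powR_ge0// ler_powR2r ?(ltW r0)//.
    by rewrite ge_min lexx orbT.
  by rewrite !powRM ?powR_ge0// mulrACA bump_normalized// mulr1.
rewrite -mulr_sumr ler_wpM2l ?mulr_ge0 ?powR_ge0// -natr_sum ler_nat.
have -> : (\sum_(k < m) (k < n) = minn m n)%N.
  elim: m => [|m IH]; first by rewrite big_ord0 min0n.
  by rewrite big_ord_recr/= IH; lia.
exact: geq_minr.
Qed.

(** The sum is at least c_k on the k-th set, and c_k^q times the power q/p of its
measure is 1. *)
Lemma lorentz_int_bump_ge (R : realType) (p q : R) (A : nat -> set R)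
    (c : nat -> R) (n : nat) :
  1 <= q -> q <= p -> (forall k, measurable (A k)) ->
  (forall k, 0 < c k) -> (forall k, 2 * c k <= c k.+1) ->
  (forall k, mu01 (A k) = (c k `^ (- p))%:E) ->
  (n%:R%:E <= 2%:E * lorentz_int q (q / p) (fun t => \sum_(k < n) bump A c k t)%R)%E.
Proof.
move=> q1 qp mA c0 c2 Ac.
have q0 : 0 < q by exact: lt_le_trans q1.
have p0 : 0 < p by exact: lt_le_trans qp.
have r0 : 0 < q / p by rewrite divr_gt0.
have r1 : q / p <= 1 by rewrite ler_pdivrMr// mul1r.
have c_ge0 k : 0 <= c k by exact: ltW.
have my : measurable_fun setT (fun t => \sum_(k < n) bump A c k t).
  by apply: measurable_sum => k; exact: measurable_bump.
have -> : n%:R = \sum_(k < n) c k `^ q * (c k `^ (- p)) `^ (q / p).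
  under eq_bigr do rewrite bump_normalized//.
  by rewrite sumr_const card_ord.
apply: (@lorentz_int_ge_lacunary _ _ _ _ c (fun k => c k `^ (- p))) => //.
- by move=> k; exact: powR_ge0.
- by move=> k; rewrite -lee_fin -Ac; exact: probability_le1.
move=> k s kn s0 sc; rewrite -lee_fin -Ac -tailE//; apply: le_measure.
- by rewrite inE.
- by rewrite inE; exact: measurable_gt_norm.
move=> u Au /=; apply: lt_le_trans sc _.
rewrite (bigD1 (Ordinal kn))//= {1}/bump indicE mem_set// mulr1.
rewrite (le_trans _ (ler_norm _))// lerDl sumr_ge0// => i _.
by rewrite /bump mulr_ge0// indicE.
Qed.

(** * Independent digits *)

(** Induction on the number of cells [j/N, (j+1)/N[ that are taken into account. *)
Lemma lebesgue_measure_cells (R : realType) (N : nat) (P : pred nat) (n : nat) : (0 < N)%N ->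
  measurable [set u : R | 0 <= u < n%:R / N%:R /\ P (Num.truncn (N%:R * u))] /\
  lebesgue_measure [set u : R | 0 <= u < n%:R / N%:R /\ P (Num.truncn (N%:R * u))] =
    ((\sum_(j < n) P j)%N%:R / N%:R)%:E.
Proof.
move=> N0; have NR : 0 < N%:R :> R by rewrite ltr0n.
elim: n => [|n [IHm IH]].
  rewrite (_ : [set u | _] = set0); last first.
    by apply/seteqP; split => u //=; rewrite mul0r => -[/andP[/le_lt_trans h /h]]; rewrite ltxx.
  by split; [exact: measurable0|rewrite measure0 big_ord0 mul0r].
set A := [set u | _] in IHm IH *.
have nN : n%:R / N%:R <= n.+1%:R / N%:R :> R by rewrite ler_pM2r ?invr_gt0// ler_nat.
have n0 : 0 <= n%:R / N%:R :> R by rewrite divr_ge0.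
pose C : set R := if P n then `[n%:R / N%:R, n.+1%:R / N%:R[%classic else set0.
have mC : measurable C by rewrite /C; case: ifP.
have -> : [set u : R | 0 <= u < n.+1%:R / N%:R /\ P (Num.truncn (N%:R * u))] = A `|` C.
  apply/seteqP; split => u /=; rewrite /A /C /=.
    move=> [/andP[u0 un] Pu]; have [un'|un'] := ltP u (n%:R / N%:R).
      by left; rewrite u0.
    right; have tn : Num.truncn (N%:R * u) = n.
      apply/eqP; rewrite truncn_eq ?mulr_ge0//.
      by rewrite -ler_pdivrMl// -ltr_pdivlMl// mulrC un'/= mulrC.
    by move: Pu; rewrite tn => -> /=; rewrite in_itv/= un' un.
  move=> [[/andP[u0 un] Pu]|]; first by rewrite u0 (lt_le_trans un nN).
  case: ifP => // Pn /=; rewrite in_itv/= => /andP[nu un].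
  have u0 : 0 <= u by exact: le_trans nu.
  rewrite u0 un; split => //.
  have -> // : Num.truncn (N%:R * u) = n.
  apply/eqP; rewrite truncn_eq ?mulr_ge0//.
  by rewrite -ler_pdivrMl// -ltr_pdivlMl// mulrC nu/= mulrC.
split; first exact: measurableU.
rewrite measureU//; last first.
  apply/seteqP; split => u //=; rewrite /A /C /= => -[[/andP[_ un] _]].
  by case: ifP => // _ /=; rewrite in_itv/= => /andP[/(lt_le_trans un)]; rewrite ltxx.
rewrite [X in (X + _)%E]IH big_ord_recr/= natrD mulrDl EFinD; congr (_ + _)%E.
rewrite /C; case: (P n); last by rewrite measure0 mul0r.
transitivity (lebesgue_measure (`[n%:R / N%:R, n.+1%:R / N%:R[%classic : set R)); first by [].
rewrite lebesgue_measure_itv/= lte_fin ltr_pM2r ?invr_gt0// ltr_nat ltnSn.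
by rewrite -EFinD -mulrBl -natrB// subSnn.
Qed.

(** [leb01] only sees the points of [0, 1], and the end point 1 is negligible. *)
Lemma leb01_cells (R : realType) (N : nat) (P : pred nat) (X : set R) : (0 < N)%N ->
  (forall u, 0 <= u < 1 -> (X u <-> P (Num.truncn (N%:R * u)))) ->
  leb01 X = ((\sum_(j < N) P j)%N%:R / N%:R)%:E.
Proof.
move=> N0 XP; have := lebesgue_measure_cells R P N N0.
rewrite divff ?pnatr_eq0 -?lt0n// => -[mC <-].
set C := [set u | _] in mC *.
(* the part of X at the end point 1 *)
pose E : set R := if pselect (X 1) then [set 1] else set0.
have mE : measurable E.
  by rewrite /E; case: pselect => _ /=; [exact: measurable_set1|exact: measurable0].
have XE : X `&` `[0, 1] = C `|` E.
  apply/seteqP; split => u /=; rewrite /C /E /=.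
    rewrite in_itv/= => -[Xu /andP[u0 u1]].
    move: u1; rewrite le_eqVlt => /predU1P[u1|u1].
      by right; case: pselect => // nX1; apply: nX1; rewrite -u1.
    by left; rewrite u0 u1; split => //; apply/XP => //; rewrite u0.
  move=> [[/andP[u0 u1] Pu]|].
    split; first by apply/XP => //; rewrite u0.
    by rewrite in_itv/= u0 ltW.
  by case: pselect => // X1 /= ->; split => //; rewrite in_itv/= ler01 lexx.
rewrite /leb01 /mrestr XE.
transitivity (lebesgue_measure C + lebesgue_measure E)%E.
  apply: measureU => //; apply/seteqP; split => u //=; rewrite /C /E /=.
  move=> [[/andP[_ u1] _]]; case: pselect => //= _ uE.
  by move: u1; rewrite uE ltxx.
have -> : lebesgue_measure E = 0%E; last by rewrite adde0.
rewrite /E; case: pselect => _ /=; [exact: lebesgue_measure_set1|exact: measure0].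
Qed.

Lemma sum_divn_modn (N b : nat) (P Q : pred nat) : (0 < b)%N ->
  (\sum_(j < N * b) (P (j %/ b) && Q (j %% b)) =
   (\sum_(i < N) P i) * (\sum_(l < b) Q l))%N.
Proof.
move=> b0; elim: N => [|N IH]; first by rewrite mul0n !big_ord0.
rewrite mulSnr big_split_ord/= IH big_ord_recr/= mulnDl; congr (_ + _)%N.
rewrite big_distrr/=; apply: eq_bigr => l _.
by rewrite divnMDl// divn_small// addn0 modnMDl modn_small// mulnb.
Qed.

Definition radix (k : nat) : nat := (4 ^ k.+1)%N.

(** The number of cells on which the first [k] digits are constant. *)
Definition cells (k : nat) : nat := (\prod_(i < k) radix i)%N.

Lemma radix_gt0 (k : nat) : (0 < radix k)%N. Proof. by rewrite expn_gt0. Qed.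

Lemma cells_gt0 (k : nat) : (0 < cells k)%N.
Proof. by apply: prodn_gt0 => i; exact: radix_gt0. Qed.

Lemma cellsS (k : nat) : cells k.+1 = (cells k * radix k)%N.
Proof. by rewrite /cells big_ord_recr. Qed.

(** The digit of index [k] is the remainder modulo [radix k] of the index of the
cell of level k+1 containing [u]. *)
Definition zero_digit (R : realType) (k : nat) (u : R) : bool :=
  (Num.truncn ((cells k.+1)%:R * u) %% radix k == 0)%N.

(** The condition that the digits of index i < k satisfy [e i], read off the index
[j] of a cell of level [k]; the cell of level k-1 containing it has index
j divided by the last radix. *)
Fixpoint zero_digits_pattern (e : nat -> pred bool) (k j : nat) : bool :=
  if k is k'.+1 then
    zero_digits_pattern e k' (j %/ radix k') && e k' (j %% radix k' == 0)%N
  else true.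

Lemma truncn_divn (R : realType) (k b : nat) (u : R) : 0 <= u -> (0 < b)%N ->
  (Num.truncn ((k * b)%N%:R * u) %/ b = Num.truncn (k%:R * u))%N.
Proof.
move=> u0 b0; apply/esym/truncn_def.
have ku : 0 <= (k * b)%N%:R * u by rewrite mulr_ge0.
set t := Num.truncn _; have /andP[tl tu] := truncn_itv ku.
have bR : 0 < b%:R :> R by rewrite ltr0n.
have e : (k * b)%N%:R * u = (k%:R * u) * b%:R by rewrite natrM mulrAC.
apply/andP; split.
  rewrite -(ler_pM2r bR) -e -natrM (le_trans _ tl)// ler_nat.
  exact: leq_trunc_div.
rewrite -(ltr_pM2r bR) -e -natrM (lt_le_trans tu)// ler_nat.
by rewrite ltn_ceil.
Qed.

Lemma zero_digits_patternP (R : realType) (e : nat -> pred bool) (k : nat) (u : R) :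
  0 <= u ->
  zero_digits_pattern e k (Num.truncn ((cells k)%:R * u)) <->
  forall i, (i < k)%N -> e i (zero_digit i u).
Proof.
move=> u0; elim: k => [|k IH] //=; rewrite /zero_digit.
have E : (Num.truncn ((cells k.+1)%:R * u) %/ radix k = Num.truncn ((cells k)%:R * u))%N.
  by rewrite cellsS truncn_divn// radix_gt0.
rewrite E; split => [/andP[/IH H ek] i|H].
  by rewrite ltnS leq_eqVlt => /predU1P[->//|/H].
by apply/andP; split; [apply/IH => i ik; apply: H; exact: ltnW|exact: H].
Qed.

(** Number of values of the digit of index [k] compatible with [e]. *)
Definition digit_count (e : pred bool) (k : nat) : nat :=
  (\sum_(l < radix k) e (l == 0 :> nat))%N.

(** Independence in its combinatorial form: the last digit ranges freely whatever
the preceding ones are. *)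
Lemma sum_zero_digits_pattern (e : nat -> pred bool) (k : nat) :
  (\sum_(j < cells k) zero_digits_pattern e k j = \prod_(i < k) digit_count (e i) i)%N.
Proof.
elim: k => [|k IH]; first by rewrite /cells !big_ord0 big_ord_recl big_ord0.
rewrite big_ord_recr/= -IH cellsS.
by rewrite (sum_divn_modn _ _ (fun l => e k (l == 0)%N)) ?radix_gt0.
Qed.

Lemma leb01_zero_digits (R : realType) (e : nat -> pred bool) (k : nat) (X : set R) :
  (forall u, 0 <= u < 1 -> (X u <-> forall i, (i < k)%N -> e i (zero_digit i u))) ->
  leb01 X = (\prod_(i < k) ((digit_count (e i) i)%:R / (radix i)%:R))%:E.
Proof.
move=> Xe; rewrite (@leb01_cells _ (cells k) (zero_digits_pattern e k)) ?cells_gt0//.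
  by rewrite sum_zero_digits_pattern /cells !natr_prod prodf_div.
move=> u /[dup] u01 /andP[u0 _]; rewrite Xe//.
exact: iff_sym (zero_digits_patternP _ _ u0).
Qed.

(** The indices below the maximum of [I] that do not belong to [I] are given the
trivial condition, and contribute the factor 1. *)
Lemma leb01_zero_digits_seq (R : realType) (e : nat -> pred bool) (I : seq nat)
    (X : set R) : uniq I ->
  (forall u, 0 <= u < 1 -> (X u <-> forall i, i \in I -> e i (zero_digit i u))) ->
  leb01 X = (\prod_(i <- I) ((digit_count (e i) i)%:R / (radix i)%:R))%:E.
Proof.
move=> uI Xe; pose e' i := if i \in I then e i else xpredT.
pose K := (\max_(i <- I) i).+1.
have IK i : i \in I -> (i < K)%N by move=> iI; rewrite ltnS leq_bigmax_seq.
rewrite (@leb01_zero_digits _ e' K); last first.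
  move=> u u01; rewrite Xe//; split => H i iI.
    by rewrite /e'; case: ifP => // /H.
  by have := H i (IK _ iI); rewrite /e' iI.
congr EFin.
rewrite (eq_bigr (fun i : 'I_K => if (i : nat) \in I then
    (digit_count (e i) i)%:R / (radix i)%:R : R else 1)); last first.
  move=> i _; rewrite /e'; case: ifP => // _.
  rewrite /digit_count sum_nat_const card_ord muln1 divff//.
  by rewrite pnatr_eq0 -lt0n radix_gt0.
rewrite -(big_mkord xpredT (fun i => if i \in I then
    (digit_count (e i) i)%:R / (radix i)%:R : R else 1)).
rewrite -big_mkcond -big_filter; apply: perm_big.
apply: uniq_perm => //; first by rewrite filter_uniq// iota_uniq.
move=> i; rewrite mem_filter mem_index_iota /=.
by case: (boolP (i \in I)) => //= /IK ->.
Qed.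

Definition digit_set (R : realType) (k : nat) : set R :=
  [set u | 0 <= u < 1 /\ zero_digit k u].

Lemma measurable_digit_set (R : realType) (k : nat) : measurable (@digit_set R k).
Proof.
have [+ _] := lebesgue_measure_cells R (fun j => (j %% radix k == 0)%N) (cells k.+1)
  (cells_gt0 k.+1).
by rewrite divff// pnatr_eq0 -lt0n cells_gt0.
Qed.

Lemma mem_digit_set (R : realType) (k : nat) (u : R) : 0 <= u < 1 ->
  (u \in digit_set k) = zero_digit k u.
Proof.
move=> u01; apply/idP/idP; first by rewrite inE => -[].
by move=> zu; rewrite inE.
Qed.

Lemma digit_count_id (k : nat) : digit_count id k = 1%N.
Proof.
rewrite /digit_count; case: (radix k) (radix_gt0 k) => // b _.
by rewrite big_ord_recl/= big1.
Qed.

Lemma mu01_digit_set (R : realType) (k : nat) :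
  mu01 (@digit_set R k) = ((radix k)%:R^-1)%:E.
Proof.
rewrite /mu01 (@leb01_zero_digits_seq _ (fun=> id) [:: k])//.
  by rewrite big_cons big_nil mulr1 digit_count_id mul1r.
move=> u u01; split => [[_ zu] i|H]; first by rewrite inE => /eqP ->.
by split => //; apply: H; rewrite inE.
Qed.

(** A condition on the value of a bump is a condition on whether a digit is zero. *)
Lemma independent_digit_bump (R : realType) (c : nat -> R) :
  independent (bump (@digit_set R) c).
Proof.
move=> I B uI mB.
pose e i (b : bool) := c i * b%:R \in B i.
have Ee i u : 0 <= u < 1 -> (bump (@digit_set R) c i @^-1` B i) u <-> e i (zero_digit i u).
  move=> u01; rewrite /e inE /preimage /= /bump indicE mem_digit_set//.
rewrite (@leb01_zero_digits_seq _ e I)//; last first.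
  move=> u u01; split => H i iI; last by apply/(Ee i _ u01); exact: H.
  by apply/(Ee i _ u01); exact: H.
rewrite -prodEFin; apply: eq_bigr => i _.
rewrite (@leb01_zero_digits_seq _ e [:: i])//; first by rewrite big_cons big_nil mulr1.
move=> u u01; split => [H j|H].
  by rewrite inE => /eqP ->; apply/(Ee i _ u01).
by apply/(Ee i _ u01); apply: H; rewrite inE.
Qed.

(** * A weakly null independent sequence spanning l_q *)

(** The height for which the digit set has measure height^(-p). *)
Definition height (R : realType) (p : R) (k : nat) : R := (radix k)%:R `^ p^-1.

Lemma height_gt0 (R : realType) (p : R) (k : nat) : 0 < height p k.
Proof. by rewrite powR_gt0// ltr0n radix_gt0. Qed.

(** The ratio 4^(1/p) is at least 2 because p <= 2. *)
Lemma height_lacunary (R : realType) (p : R) (k : nat) : 0 < p -> p <= 2 ->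
  2 * height p k <= height p k.+1.
Proof.
move=> p0 p2; rewrite /height.
have -> : (radix k.+1)%:R = 4 * (radix k)%:R :> R by rewrite /radix expnS natrM.
rewrite powRM// ler_wpM2r ?powR_ge0//.
have -> : (4 : R) = 2 `^ 2 by rewrite powR_mulrn// -natrX.
rewrite -powRrM -[leLHS]powRr1//; apply: ler_powR; first by rewrite ler1n.
by rewrite ler_pdivlMr// mul1r.
Qed.

Lemma mu01_digit_set_height (R : realType) (p : R) (k : nat) : 0 < p ->
  mu01 (@digit_set R k) = (height p k `^ (- p))%:E.
Proof.
move=> p0; rewrite mu01_digit_set /height -powRrM mulrN mulVf ?gt_eqF//.
by rewrite powR_inv1.
Qed.

Lemma height_subseq (R : realType) (p : R) (k : nat -> nat) : 0 < p -> p <= 2 ->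
  increasing_seq k -> forall i, 2 * height p (k i) <= height p (k i.+1).
Proof.
move=> p0 p2 /increasing_seqP kinc i.
have hmono : {homo @height R p : m n / (m <= n)%N >-> m <= n}.
  apply: homo_leq => [m|y m n|m]; [exact: lexx|exact: le_trans|].
  rewrite (le_trans _ (height_lacunary m p0 p2))// ler_peMl ?(ltW (height_gt0 _ _))//.
  by rewrite ler1n.
apply: le_trans (height_lacunary _ p0 p2) _; apply: hmono.
by have := kinc i; rewrite ltEnat.
Qed.

Definition digit_bump (R : realType) (p : R) : nat -> R -> R :=
  bump (@digit_set R) (height p).

Definition bump_const (R : realType) (p q : R) : R :=
  q / p * (integral_powR_const (q / p) * (2 `^ q * 2 `^ (q / p))) `^ q^-1.

(** A subsequence of lacunary bumps is again of the same kind, so the constant does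
not depend on it. *)
Lemma lorentz_norm_digit_bump_le (R : realType) (p q : R) (k : nat -> nat)
    (s : nat -> R) (n : nat) :
  1 <= q -> q <= p -> p <= 2 -> increasing_seq k -> (forall i, `|s i| <= 1) ->
  (lorentz_norm p q (fun t => \sum_(i < n) s i * digit_bump p (k i) t)%R <=
     (bump_const p q * n%:R `^ q^-1)%:E)%E.
Proof.
move=> q1 qp p2 kinc s1.
have q0 : 0 < q by exact: lt_le_trans q1.
have p0 : 0 < p by exact: lt_le_trans qp.
have r0 : 0 < q / p by rewrite divr_gt0.
have K0 : 0 <= integral_powR_const (q / p) * (2 `^ q * 2 `^ (q / p)).
  by apply: mulr_ge0; [exact: integral_powR_const_ge0|rewrite mulr_ge0 ?powR_ge0].
rewrite /bump_const -mulrA -powRM//.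
apply: lorentz_norm_le => //; first exact: mulr_ge0.
rewrite -mulrA.
apply: (@lorentz_int_bump_le _ p q (fun i => digit_set (k i)) (fun i => height p (k i)) s n) => //.
- by move=> i; exact: measurable_digit_set.
- by move=> i; exact: height_gt0.
- exact: height_subseq.
- by move=> i; exact: mu01_digit_set_height.
Qed.

Lemma fspace_digit_bump_sum (R : realType) (p q : R) (k : nat -> nat)
    (s : nat -> R) (n : nat) :
  1 <= q -> q <= p -> p <= 2 -> increasing_seq k -> (forall i, `|s i| <= 1) ->
  fspace (lorentz_norm p q) (fun t => \sum_(i < n) s i * digit_bump p (k i) t).
Proof.
move=> q1 qp p2 kinc s1; split.
  apply: measurable_funTS; apply: measurable_sum => i.
  by apply: measurable_funM => //; apply: measurable_bump; exact: measurable_digit_set.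
by apply: le_lt_trans (lorentz_norm_digit_bump_le n q1 qp p2 kinc s1) _; exact: ltry.
Qed.

Lemma fspace_digit_bump (R : realType) (p q : R) (m : nat) :
  1 <= q -> q <= p -> p <= 2 -> fspace (lorentz_norm p q) (digit_bump p m).
Proof.
move=> q1 qp p2.
(* a single bump as a sum of length one along the subsequence starting at m *)
have kinc : increasing_seq (fun i => (m + i)%N).
  by apply/increasing_seqP => i; rewrite ltEnat /= ltn_add2l.
have := @fspace_digit_bump_sum _ p q _ (fun=> 1) 1 q1 qp p2 kinc.
rewrite normr1 => /(_ (fun=> lexx _)).
congr fspace; apply/funext => t.
by rewrite big_ord_recl big_ord0 addr0 mul1r addn0.
Qed.

Lemma fdual_digit_bump_sum (R : realType) (p q : R) (phi : (R -> R) -> R)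
    (k : nat -> nat) (s : nat -> R) (n : nat) :
  1 <= q -> q <= p -> p <= 2 -> increasing_seq k -> (forall i, `|s i| <= 1) ->
  fdual (lorentz_norm p q) phi ->
  phi (fun t => \sum_(i < n) s i * digit_bump p (k i) t) =
  \sum_(i < n) s i * phi (digit_bump p (k i)).
Proof.
move=> q1 qp p2 kinc s1 [lin _].
elim: n => [|n IH].
  have f0 := fspace_digit_bump_sum 0 q1 qp p2 kinc s1.
  have := lin (-1) _ _ f0 f0; rewrite mulN1r addNr => phi0.
  rewrite big_ord0 -[RHS]phi0.
  by congr phi; apply/funext => t; rewrite !big_ord0 mulr0 addr0.
rewrite [RHS]big_ord_recr/= -IH addrC -lin; last 2 first.
- exact: fspace_digit_bump.
- exact: fspace_digit_bump_sum.
by congr phi; apply/funext => t; rewrite big_ord_recr/= addrC.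
Qed.

(** Otherwise some |phi(x_k)| stay above e along a subsequence; with s_k the sign of
phi(x_k), applying phi to the sum of the s_k x_k gives n e = O(n^(1/q)) with
1/q < 1. *)
Lemma weakly_null_digit_bump (R : realType) (p q : R) : 1 < q -> q <= p -> p <= 2 ->
  weakly_null (lorentz_norm p q) (digit_bump p).
Proof.
move=> q1 qp p2; have q1' := ltW q1.
have q0 : 0 < q by exact: lt_trans q1.
split; first by move=> m; exact: fspace_digit_bump.
move=> phi fphi; have [_ [C phiC]] := fphi.
apply/cvgrPdist_lt => e e0.
apply: contrapT => notnear.
have bad m : exists n, (m < n)%N /\ e <= `|phi (digit_bump p n)|.
  apply: contrapT => none; apply: notnear; exists m.+1 => // n /= mn.
  rewrite sub0r normrN ltNge; apply/negP => en; apply: none.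
  by exists n.
have [f fbad] := choice bad.
pose k n := iter n f (f 0%N).
have kinc : increasing_seq k.
  by apply/increasing_seqP => i; rewrite ltEnat /=; have [] := fbad (k i).
have kbad i : e <= `|phi (digit_bump p (k i))|.
  by case: i => [|i]; [have [] := fbad 0%N|have [] := fbad (k i)].
pose s i := Num.sg (phi (digit_bump p (k i))).
have s1 i : `|s i| <= 1.
  by rewrite /s; case: sgrP => _; rewrite ?normr0 ?normrN1 ?normr1// ler01.
have qV1 : q^-1 < 1 by rewrite invf_lt1.
apply: (@powR_growth_contra _ q^-1 1 e (`|C| * bump_const p q) qV1 e0) => n n0.
rewrite powRr1// mulr_natr.
apply: (@le_trans _ _ (phi (fun t => \sum_(i < n) s i * digit_bump p (k i) t))).
  rewrite (fdual_digit_bump_sum n q1' qp p2 kinc s1 fphi).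
  rewrite -[leLHS](_ : \sum_(i < n) e = _); last by rewrite sumr_const card_ord.
  by apply: ler_sum => i _; rewrite /s -normrEsg.
apply: le_trans (ler_norm _) _; rewrite -lee_fin.
have fS := fspace_digit_bump_sum n q1' qp p2 kinc s1.
apply: le_trans (phiC _ fS) _.
have := lorentz_norm_digit_bump_le n q1' qp p2 kinc s1.
set N := lorentz_norm _ _ _ => NS.
have N0 : (0 <= N)%E.
  have p0 : 0 < p by exact: lt_le_trans qp.
  rewrite /N lorentz_normE// mule_ge0 ?poweR_ge0// lee_fin divr_ge0// ltW//.
apply: (@le_trans _ _ (`|C|%:E * N)%E).
  by apply: lee_wpmul2r => //; rewrite lee_fin ler_norm.
rewrite -mulrA EFinM; apply: lee_wpmul2l => //.
Qed.

(** Along every subsequence the norm of the sum of n terms is at least a constant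
times n^(1/q), and 1/q > 1/p. *)
Lemma not_Gamma_i_lorentz (R : realType) (p q : R) : 1 < q -> q < p -> p <= 2 ->
  ~ Gamma_i (lorentz_norm p q) p.
Proof.
move=> q1 qp p2 [_ Gp]; have q1' := ltW q1; have qp' := ltW qp.
have q0 : 0 < q by exact: lt_trans q1.
have p0 : 0 < p by exact: lt_trans qp.
have [k kinc [_ _ BS]] := Gp _ (weakly_null_digit_bump q1 qp' p2)
  (independent_digit_bump (height p)).
have := BS id (fun _ _ => erefl _).
set S := ereal_sup _ => Sfin.
have S0 : (0 <= S)%E.
  apply: le_ereal_sup_tmp; eexists; first by exists 1%N.
  rewrite mule_ge0 ?lee_fin ?powR_ge0// lorentz_normE// mule_ge0 ?poweR_ge0//.
  by rewrite lee_fin divr_ge0 ?ltW.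
have SE : S = (fine S)%:E by rewrite fineK// ge0_fin_numE.
have pq : p^-1 < q^-1 by rewrite ltf_pV2.
apply: (@powR_growth_contra _ p^-1 q^-1 (q / p * 2^-1 `^ q^-1) (fine S) pq) => [|n n0].
  by rewrite mulr_gt0 ?divr_gt0 ?powR_gt0 ?invr_gt0.
have nR : 0 < n%:R :> R by rewrite ltr0n.
have : ((n%:R `^ (- p^-1))%:E * lorentz_norm p q
    (fun t => \sum_(i < n) digit_bump p (k i) t)%R <= (fine S)%:E)%E.
  by rewrite -SE; apply: ereal_sup_ubound; exists n.
have Ige : ((n%:R / 2)%:E <= lorentz_int q (q / p)
    (fun t => \sum_(i < n) digit_bump p (k i) t)%R)%E.
  have := @lorentz_int_bump_ge _ p q (fun i => digit_set (k i))
    (fun i => height p (k i)) n q1' qp'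
    (fun i => @measurable_digit_set R (k i)) (fun i => height_gt0 _ _)
    (height_subseq p0 p2 kinc) (fun i => mu01_digit_set_height _ p0).
  by rewrite muleC -lee_pdivrMr// EFinM.
have Nge := lorentz_norm_ge p0 q0 (divr_ge0 (ltW nR) (ler0n _ 2)) Ige.
have nV : (0 <= (n%:R `^ (- p^-1))%:E :> \bar R)%E by rewrite lee_fin powR_ge0.
move/(le_trans (lee_wpmul2l nV Nge)); rewrite -EFinM lee_fin powRN.
rewrite ler_pdivrMl ?powR_gt0// powRM ?invr_ge0// => H.
rewrite [leRHS]mulrC; apply: le_trans H.
by rewrite le_eqVlt; apply/orP; left; apply/eqP; ring.
Qed.

Theorem mainTheorem8 (R : realType) (p q : R)
  (hq : 1 < q) (hqp : q < p) (hp : p < 2) :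
  Gamma_i (lorentz_norm p q) <> Gamma_iid (lorentz_norm p q).
Proof.
move=> GE; apply: (@not_Gamma_i_lorentz _ p q) => //; first exact: ltW.
rewrite GE; apply: Gamma_iid_lorentz => //; [exact: ltW|exact: ltW|].
exact: lt_trans hqp.
Qed.
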